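(* Let $n,k,l\in\mathbb{N}$ with $n\geq k\geq l$. For every $r\leq 2(k-l)+1$, $\pi_r(S(n,k,l))=0$.
   Context: $\mathbb{N}$ denotes the positive integers. For $n\geq k\geq l$ in $\mathbb{N}$, $S(n,k,l)=\{b\in M_n(\mathbb{C}) : b \text{ is non-negative definite and } l\leq \operatorname{rank}(b)\leq k\}$, with the subspace topology induced by the norm topology of $M_n(\mathbb{C})$. $\pi_r$ denotes the $r$-th homotopy group (set, for $r=0$), $r$ being a non-negative integer; the vanishing of $\pi_0$ means path connectedness. *)

(* Defs.v *)
From mathcomp Require Import all_boot all_order all_algebra.
From mathcomp Require Import complex.
From mathcomp Require Import all_classical all_reals topology normedtype.

Set Implicit Arguments.
Unset Strict Implicit.
Unset Printing Implicit Defensive.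

Import Order.TTheory GRing.Theory Num.Theory.
Import numFieldNormedType.Exports.

Local Open Scope classical_set_scope.
Local Open Scope ring_scope.
Local Open Scope sesquilinear_scope.

(* The type ascription gives matrices over [Cplx R] the topology that
   MathComp-Analysis attaches to any [numFieldType]; [R[i]] itself carries no
   declared topology. *)
Definition Cplx (R : realType) : numClosedFieldType := R[i].

(* In [R[i]], [0 <= z] says that [z] is real and nonnegative. *)
Definition nonneg_definite (R : realType) (n : nat) (b : 'M[Cplx R]_n) : Prop :=
  b \is hermsymmx /\
  forall v : 'cV[Cplx R]_n, 0 <= (v ^t* *m b *m v) ord0 ord0.

Definition psd_rank (R : realType) (n k l : nat) : set 'M[Cplx R]_n :=
  [set b | nonneg_definite b /\ (l <= \rank b <= k)%N].
Arguments psd_rank : clear implicits.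

(* S(n, k, l) as a space: [set_type] carries the subspace topology (initial for
   the inclusion), whereas [subspace] would be a topology on all of 'M_n. *)
Definition psd_rank_space (R : realType) (n k l : nat) : topologicalType :=
  set_type (psd_rank R n k l).

Section homotopy_groups.
Context {R : realType}.
Implicit Types (X : topologicalType) (r : nat).

Definition cube r : set 'rV[R]_r :=
  [set t | forall i, t ord0 i \in `[0, 1]].

Definition cube_boundary r : set 'rV[R]_r :=
  [set t | cube t /\ exists i, t ord0 i = 0 \/ t ord0 i = 1].

(* Maps of pairs (I^r, dI^r) -> (X, x0), represented by total functions of which
   only the restriction to the cube matters. *)
Definition spheroid X r (x0 : X) : set ('rV[R]_r -> X) :=
  [set f | {within @cube r, continuous f} /\
           forall t, cube_boundary t -> f t = x0].

Definition homotopic X r (x0 : X) (f g : 'rV[R]_r -> X) : Prop :=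
  exists H : R * 'rV[R]_r -> X,
    [/\ {within `[0, 1] `*` @cube r, continuous H},
        forall t, cube t -> H (0, t) = f t,
        forall t, cube t -> H (1, t) = g t &
        forall (s : R) t, s \in `[0, 1] -> cube_boundary t -> H (s, t) = x0].

Definition homotopy_class X r (x0 : X) (f : 'rV[R]_r -> X) :
    set ('rV[R]_r -> X) :=
  [set g | spheroid x0 g /\ homotopic x0 f g].

(* Underlying set of pi_r(X, x0); for r >= 1 the class of the constant map is
   the neutral element of the group. *)
Definition homotopy_group X r (x0 : X) : set (set ('rV[R]_r -> X)) :=
  homotopy_class x0 @` spheroid x0.

Definition path_connected X : Prop :=
  inhabited X /\
  forall x y : X, exists gamma : R -> X,
    [/\ {within `[0, 1], continuous gamma}, gamma 0 = x & gamma 1 = y].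

(* pi_r(X) = 0; for r >= 1, at every base point. *)
Definition homotopy_group_vanishes r X : Prop :=
  if r is 0 then path_connected X
  else forall x0 : X,
    @homotopy_group X r x0 = [set homotopy_class x0 (cst x0)].

End homotopy_groups.
Arguments homotopy_group_vanishes R r X : clear implicits.

(* Main.v *)
(** Let m = k - l + 2 and write lambda_1 >= ... >= lambda_n for the eigenvalues
    of a Hermitian matrix.  If k = n the space is convex.  If k < n, the map
    b |-> (b - lambda_(k+1)(b))_+ retracts the set of Hermitian matrices with
    lambda_l > lambda_(k+1) onto S(n, k, l).  The complement of this set
    consists of matrices having an eigenvalue c of multiplicity at least m;
    such a b is c + alpha A alpha^* where alpha has at most n - m nonzero columns
    and is the identity on the corresponding rows, so finitely many charts with
    at most n^2 - m^2 + 1 real parameters cover them.  Taking alpha from a maximal minor makes its entries bounded by 1.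

    The straight-line homotopy between two maps on the r-cube is a map on a box
    of dimension r + 1 <= 2 m - 2 < m^2 - 1.  It is approximated by a Lipschitz
    map; by pigeonhole on a fine grid some small translate misses all the
    charts.  Interpolating with the original map where the gap
    lambda_l - lambda_(k+1) is large leaves the boundary unchanged, and the
    retraction brings the result back to S(n, k, l).  *)
Require Import Defs.
From mathcomp Require Import all_boot all_order all_algebra.
From mathcomp Require Import complex.
From mathcomp Require Import all_classical all_reals topology normedtype.
From mathcomp Require Import derive.
From mathcomp Require Import ring lra zify.

Set Implicit Arguments.
Unset Strict Implicit.
Unset Printing Implicit Defensive.

Import Order.TTheory GRing.Theory Num.Theory Num.Def.
Import numFieldNormedType.Exports.

Local Open Scope ring_scope.
Local Open Scope sesquilinear_scope.

(** * Spectral decompositions *)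

Section Diagonal.
Variable F : fieldType.

Lemma mxrank_sum_le (I : finType) (P : pred I) m n (A : I -> 'M[F]_(m, n)) :
  (\rank (\sum_(i | P i) A i)%R <= \sum_(i | P i) \rank (A i))%N.
Proof.
elim/big_ind2: _ => [|A1 r1 A2 r2 h1 h2|//]; first by rewrite mxrank0.
by apply: (leq_trans (mxrank_add _ _)); rewrite leq_add.
Qed.

Lemma rank_diag_mx_le n (d : 'rV[F]_n) :
  (\rank (diag_mx d) <= #|[set i | (d 0 i != 0)%R]|)%N.
Proof.
have -> : diag_mx d = \sum_(i in [set i | d 0 i != 0]) (d 0 i *: delta_mx i i).
  rewrite diag_mx_sum_delta [LHS](bigID (mem [set i | d 0 i != 0])) /= addrC.
  rewrite big1 ?add0r// => i; rewrite inE negbK => /eqP ->.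
  by rewrite scale0r.
apply: (leq_trans (mxrank_sum_le _ _)); rewrite -sum1_card leq_sum// => i _.
by apply: (leq_trans (mxrank_scale _ _)); rewrite mxrank_delta.
Qed.

(** For the lower bound, adding the indicator of the zero entries gives an invertible diagonal
    matrix, and the rank is subadditive. *)
Lemma rank_diag_mx n (d : 'rV[F]_n) :
  \rank (diag_mx d) = #|[set i | d 0 i != 0]|.
Proof.
apply/eqP; rewrite eqn_leq rank_diag_mx_le /=.
pose e : 'rV[F]_n := \row_i (d 0 i == 0)%:R.
have full : \rank (diag_mx (d + e)) = n.
  apply: mxrank_unit; rewrite unitmxE det_diag unitfE; apply/prodf_neq0 => i _.
  by rewrite !mxE; have [->|?] := eqVneq (d 0 i) 0; rewrite ?add0r ?oner_eq0 // addr0.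
have := mxrank_add (diag_mx d) (diag_mx e).
rewrite -raddfD /= full.
have -> : [set i | d 0 i != 0] = ~: [set i | e 0 i != 0].
  by apply/setP => i; rewrite !inE negbK mxE; case: eqVneq; rewrite ?oner_eq0 ?eqxx.
have := rank_diag_mx_le e; have := cardsC [set i | e 0 i != 0].
rewrite card_ord; move: #|_| #|_| (\rank _) (\rank _) => *; lia.
Qed.

End Diagonal.

Section Spectrum.
Variable C : numClosedFieldType.
Implicit Types (n : nat).

(** When [U] is unitary, its row [i] is a left eigenvector for the eigenvalue [d 0 i]. *)
Definition specmx n (U : 'M[C]_n) (d : 'rV[C]_n) : 'M[C]_n :=
  U^t* *m diag_mx d *m U.
Definition qform n (a : 'M[C]_n) (w : 'rV[C]_n) : C := (w *m a *m w^t* ) 0 0.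

Lemma rank_specmx n (U : 'M[C]_n) d : U \is unitarymx ->
  \rank (specmx U d) = #|[set i | d 0%R i != 0%R]|.
Proof.
move=> Uu; have Uunit := unitarymx_unit Uu.
rewrite /specmx mxrankMfree ?row_free_unit // -rank_diag_mx.
have Ufull : row_full (U^t* ) by rewrite row_full_unit unitarymx_unit // trmxC_unitary.
by rewrite (eqmxMfull _ Ufull).
Qed.

Lemma specmxD n (U : 'M[C]_n) d e :
  specmx U (d + e) = specmx U d + specmx U e.
Proof. by rewrite /specmx raddfD /= mulmxDr mulmxDl. Qed.

Lemma specmxN n (U : 'M[C]_n) d : specmx U (- d) = - specmx U d.
Proof. by rewrite /specmx raddfN /= mulmxN mulNmx. Qed.

Lemma specmxM n (U : 'M[C]_n) d e : U \is unitarymx ->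
  specmx U d *m specmx U e = specmx U (\row_i (d 0 i * e 0 i)).
Proof.
move=> Uu; rewrite /specmx !mulmxA (mulmxtVK _ Uu); congr (_ *m _).
by rewrite -mulmxA mulmx_diag.
Qed.

Lemma specmx_const n (U : 'M[C]_n) (c : C) : U \is unitarymx ->
  specmx U (const_mx c) = c%:M.
Proof.
move=> Uu; rewrite /specmx diag_const_mx mul_mx_scalar -scalemxAl.
by rewrite -(invmx_unitary Uu) mulVmx ?unitarymx_unit// scalemx1.
Qed.

Lemma hermsymmxE n (a : 'M[C]_n) : (a \is hermsymmx) = (a == a^t* ).
Proof. by rewrite is_hermitianmxE expr0 scale1r. Qed.

Lemma specmx_herm n (U : 'M[C]_n) d : d \is a realmx -> specmx U d \is hermsymmx.
Proof.
move=> dr; rewrite hermsymmxE /specmx !trmx_mul !map_mxM /= trmxCK.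
by rewrite tr_diag_mx map_diag_mx (realmxC dr) mulmxA.
Qed.

Lemma qform_specmx n (U : 'M[C]_n) d w :
  qform (specmx U d) w = \sum_i d 0 i * `|(w *m U^t* ) 0 i| ^+ 2.
Proof.
rewrite /qform /specmx.
have -> : w *m (U^t* *m diag_mx d *m U) *m w^t* =
   (w *m U^t* ) *m diag_mx d *m (w *m U^t* )^t*.
  by rewrite !trmx_mul !map_mxM /= trmxCK !mulmxA.
rewrite mxE; apply: eq_bigr => i _.
rewrite mul_mx_diag [X in X * _]mxE [X in _ * X]mxE [X in _ * conjC X]mxE normCK.
by rewrite [_ * d 0 i]mulrC mulrA.
Qed.

Lemma specmx_spectral n (a : 'M[C]_n) : a \is hermsymmx ->
  a = specmx (spectralmx a) (spectral_diag a).
Proof.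
move=> ha; have /orthomx_spectralP {1}-> := hermitian_normalmx ha.
by rewrite invmx_unitary ?spectral_unitarymx.
Qed.

(* Otherwise the space where the first form is positive definite would meet the
   space where the second one is nonpositive. *)
Lemma specmx_monotone n (U V : 'M[C]_n) d e :
  U \is unitarymx -> V \is unitarymx -> e \is a realmx ->
  (forall w, qform (specmx U d) w <= qform (specmx V e) w) ->
  (#|[set i | (0 < d 0 i)%R]| <= #|[set i | (0 < e 0 i)%R]|)%N.
Proof.
move=> Uu Vu er le_ab; rewrite leqNgt; apply/negP => lt_card.
pose ind (f : 'rV[C]_n) : 'rV[C]_n := \row_i (0 < f 0 i)%R%:R.
have rk_ind f : \rank (diag_mx (ind f)) = #|[set i | (0 < f 0 i)%R]|.
  rewrite rank_diag_mx; apply: eq_card => i; rewrite !inE mxE.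
  by case: (0 < f 0 i)%R; rewrite ?oner_eq0 ?eqxx.
(* The intersection [W] holds the vectors whose coordinates along the rows of [U] live where [d] is
   positive and whose coordinates along the rows of [V] vanish where [e] is positive. The assumed
   strict inequality makes it nonzero by a dimension count. *)
pose K := kermx (U *m V^t* *m diag_mx (ind e)).
pose W := (diag_mx (ind d) :&: K)%MS.
have Wn0 : W != 0.
  rewrite -mxrank_eq0 -lt0n.
  have rkK : \rank K = (n - #|[set i | (0 < e 0 i)%R]|)%N.
    have UVfull : row_full (U *m V^t* ).
      by rewrite row_full_unit unitarymx_unit // mul_unitarymx // trmxC_unitary.
    by rewrite /K mxrank_ker (eqmxMfull _ UVfull) rk_ind.
  have := mxrank_sum_cap (diag_mx (ind d)) K; rewrite -/W rk_ind rkK.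
  have := rank_leq_col (diag_mx (ind d) + K)%MS.
  have : (#|[set i | (0 < e 0 i)%R]| <= n)%N.
    by rewrite -[X in (_ <= X)%N]card_ord max_card.
  lia.
have [i Wi0] : exists i, row i W != 0.
  apply/existsP; move: Wn0; apply: contraR; rewrite negb_exists => /forallP W0.
  by apply/eqP/row_matrixP => i; have := W0 i; rewrite negbK row0 => /eqP.
set x := row i W in Wi0.
have xd : (x <= diag_mx (ind d))%MS by rewrite (submx_trans (row_sub _ _)) ?capmxSl.
have xK : x *m (U *m V^t* *m diag_mx (ind e)) = 0.
  by apply/sub_kermxP; rewrite (submx_trans (row_sub _ _)) ?capmxSr.
have x0 j : ~~ (0 < d 0 j) -> x 0 j = 0.
  case/submxP: xd => y -> /negbTE dj; rewrite mul_mx_diag !mxE dj.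
  by rewrite mulr0.
have {}xK j : 0 < e 0 j -> (x *m U *m V^t* ) 0 j = 0.
  move=> ej; move: xK; rewrite !mulmxA mul_mx_diag => /rowP/(_ j).
  rewrite [LHS]mxE [X in _ * X]mxE /ind ej mulr1 => ->.
  by rewrite mxE.
suff lt0 : 0 < qform (specmx U d) (x *m U).
  suff le0 : qform (specmx V e) (x *m U) <= 0.
    by have := lt_le_trans lt0 (le_trans (le_ab _) le0); rewrite ltxx.
  rewrite qform_specmx; apply: sumr_le0 => j _; have [/xK ->|ej] := boolP (0 < e 0 j).
    by rewrite normr0 expr0n mulr0.
  by rewrite mulr_le0_ge0 ?exprn_ge0 // real_leNgt // (mxOverP er).
rewrite qform_specmx -mulmxA (elimT unitarymxP Uu) mulmx1.
have terms_ge0 j : 0 <= d 0 j * `|x 0 j| ^+ 2 :> C.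
  have [dj|/x0 ->] := boolP (0 < d 0 j); first by rewrite mulr_ge0 ?exprn_ge0 // ltW.
  by rewrite normr0 expr0n mulr0.
have [j xj] : exists j, x 0 j != 0 by apply/rV0Pn.
rewrite (bigD1 j) //= ltr_pwDl ?sumr_ge0 //.
rewrite mulr_gt0 ?exprn_gt0 ?normr_gt0 //.
by apply: contraR xj => /x0 ->.
Qed.
End Spectrum.

(** * Truncation of eigenvalues *)

Section PositivePart.
Variable C : numClosedFieldType.
Implicit Types (n : nat).

(** The order of [C] is partial: the default 0 is also taken off the real axis. *)
Definition posr (x : C) : C := if 0 <= x then x else 0.

Lemma posr_ge0 x : 0 <= posr x.
Proof. by rewrite /posr; case: ifP. Qed.

Lemma posr_id x : 0 <= x -> posr x = x.
Proof. by rewrite /posr => ->. Qed.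

Lemma posrBN x : x \is Num.real -> posr x - posr (- x) = x.
Proof.
rewrite /posr oppr_ge0 realE => /orP[] hx; rewrite hx; case: ifP => h.
- by have -> : x = 0 by [apply: le_anti; rewrite hx h]; rewrite oppr0 subr0.
- by rewrite subr0.
- by have -> : x = 0 by [apply: le_anti; rewrite hx h]; rewrite oppr0 subr0.
- by rewrite sub0r opprK.
Qed.

Lemma posrMN x : posr x * posr (- x) = 0.
Proof.
rewrite /posr oppr_ge0; case: ifP => hx; case: ifP => h; rewrite ?mulr0 ?mul0r//.
by have -> : x = 0 by [apply: le_anti; rewrite hx h]; rewrite mul0r.
Qed.

Lemma posr_neq0 x : x \is Num.real -> (posr x != 0) = (0 < x).
Proof.
by rewrite /posr lt0r => xr; case: ifP; rewrite ?andbT ?andbF ?eqxx.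
Qed.

Definition psd n (a : 'M[C]_n) := a \is hermsymmx /\ forall w, 0 <= qform a w.

Lemma psd_specmx n (U : 'M[C]_n) (d : 'rV[C]_n) :
  (forall i, 0 <= d 0 i) -> psd (specmx U d).
Proof.
move=> d0; split; first by apply/specmx_herm/mxOverP => i j; rewrite ord1 ger0_real.
by move=> w; rewrite qform_specmx sumr_ge0 // => i _; rewrite mulr_ge0 ?exprn_ge0.
Qed.

Lemma spectral_diag_qform n (a : 'M[C]_n) i : a \is hermsymmx ->
  spectral_diag a 0 i = qform a (row i (spectralmx a)).
Proof.
move=> ha; rewrite {2}(specmx_spectral ha) qform_specmx.
have rowE j : (row i (spectralmx a) *m (spectralmx a)^t* ) 0 j = (i == j)%:R.
  by rewrite -row_mul (elimT unitarymxP (spectral_unitarymx a)) !mxE.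
rewrite (bigD1 i) //= rowE eqxx normr1 expr1n mulr1 big1 ?addr0 // => j ji.
by rewrite rowE eq_sym (negbTE ji) normr0 expr0n mulr0.
Qed.

Lemma psd_spectral_diag n (a : 'M[C]_n) i : psd a -> 0 <= spectral_diag a 0 i.
Proof. by case=> ha qa; rewrite spectral_diag_qform. Qed.

(** Diagonalising [p] turns the trace into the sum of its eigenvalues times the values of the form
    of [q] at its eigenvectors. *)
Lemma trace_psdM n (p q : 'M[C]_n) : psd p -> psd q -> 0 <= \tr (p *m q).
Proof.
move=> pp [_ q0]; have [hp _] := pp.
rewrite (specmx_spectral hp) /specmx -!mulmxA mxtrace_mulC -!mulmxA.
rewrite /mxtrace sumr_ge0 // => i _; rewrite mul_diag_mx mxE.
rewrite mulr_ge0 ?psd_spectral_diag //.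
set P := spectralmx p.
suff <- : qform q (row i P) = (P *m (q *m P^t* )) i i by [].
rewrite /qform mulmxA -row_mul mxE [RHS]mxE; apply: eq_bigr => j _.
by rewrite [X in X * _]mxE; congr (_ * _); rewrite !mxE.
Qed.

Definition truncmx n (a : 'M[C]_n) (c : C) : 'M[C]_n :=
  specmx (spectralmx a) (\row_i posr (spectral_diag a 0 i - c)).

Lemma psd_truncmx n (a : 'M[C]_n) c : psd (truncmx a c).
Proof. by apply: psd_specmx => i; rewrite mxE posr_ge0. Qed.

(** The witness is the negative part of [a - c%:M]. This is the Moreau decomposition along the
    positive semidefinite cone, in the form that [trace_contract] takes as input. *)
Lemma truncmx_decomp n (a : 'M[C]_n) c : a \is hermsymmx -> c \is Num.real ->
  exists p', [/\ psd p', truncmx a c - p' = a - c%:M,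
    truncmx a c *m p' = 0 & p' *m truncmx a c = 0].
Proof.
move=> ha cr; have Uu := spectral_unitarymx a.
exists (specmx (spectralmx a) (\row_i posr (- (spectral_diag a 0 i - c)))).
have diag0 (U : 'M[C]_n) : specmx U 0 = 0.
  by rewrite /specmx raddf0 mulmx0 mul0mx.
split.
- by apply: psd_specmx => i; rewrite mxE posr_ge0.
- rewrite {4}(specmx_spectral ha) -(specmx_const _ Uu) -!specmxN -!specmxD.
  congr specmx; apply/rowP => i; rewrite !mxE posrBN // realB //.
  by have /mxOverP := hermitian_spectral_diag_real ha.
- rewrite specmxM // -[RHS](diag0 (spectralmx a)); congr specmx.
  by apply/rowP => i; rewrite !mxE posrMN.
- rewrite specmxM // -[RHS](diag0 (spectralmx a)); congr specmx.
  by apply/rowP => i; rewrite !mxE mulrC posrMN.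
Qed.

Lemma trace_adj n (a : 'M[C]_n) : \tr (a *m a^t* ) = \sum_i \sum_j `|a i j| ^+ 2.
Proof.
apply: eq_bigr => i _; rewrite mxE; apply: eq_bigr => j _.
by rewrite !mxE normCK.
Qed.

(* The positive part is the metric projection onto the cone of positive
   semidefinite matrices, hence nonexpansive for the Frobenius norm. *)
Lemma trace_contract n (p p' q q' : 'M[C]_n) :
  psd p -> psd p' -> psd q -> psd q' ->
  p *m p' = 0 -> p' *m p = 0 -> q *m q' = 0 -> q' *m q = 0 ->
  \tr ((p - q) *m (p - q)^t* ) <=
  \tr ((p - p' - (q - q')) *m (p - p' - (q - q'))^t* ).
Proof.
move=> pp pp' pq pq' e1 e2 e3 e4.
have adjE (a : 'M[C]_n) : psd a -> a^t* = a by case; rewrite hermsymmxE => /eqP <-.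
have adjB (a b : 'M[C]_n) : (a - b)^t* = a^t* - b^t*.
  by rewrite !raddfB.
rewrite !adjB !adjE // -subr_ge0.
have -> : (p - p' - (q - q')) = (p - q) - (p' - q') by rewrite !opprD !opprK addrACA.
set s := p - q; set t := p' - q'.
have -> : (s - t) *m (s - t) = s *m s - s *m t + (t *m t - t *m s).
  by move: s t => s t; rewrite mulmxBl !mulmxBr opprB.
have -> : \tr (s *m s - s *m t + (t *m t - t *m s)) =
    \tr (s *m s) + (\tr (t *m t) - \tr (s *m t) - \tr (s *m t)).
  move: s t => s t; rewrite !raddfD !raddfN /= [\tr (t *m s)]mxtrace_mulC.
  by rewrite -addrA; congr (_ + _); rewrite addrCA addrA.
rewrite addrC addKr.
(* Only mixed products survive: [s *m t] equals [- (p *m q' + q *m p')]. *)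
have tst : \tr (s *m t) <= 0.
  rewrite /s /t mulmxBl !mulmxBr e1 e3 sub0r subr0 raddfB raddfN /=.
  by rewrite -opprD oppr_le0 addr_ge0 // trace_psdM.
have tt : 0 <= \tr (t *m t).
  have -> : t *m t = t *m t^t* by rewrite adjB !adjE.
  by rewrite trace_adj sumr_ge0 // => i _; rewrite sumr_ge0 // => j _; rewrite exprn_ge0.
by rewrite !addr_ge0 ?oppr_ge0.
Qed.

(** Truncation contracts the Frobenius norm; the factor [n] comes from bounding that norm by the
    largest of the [n ^ 2] entries. *)
Lemma truncmx_lipschitz n (a b : 'M[C]_n) (c c' e : C) :
  a \is hermsymmx -> b \is hermsymmx -> c \is Num.real -> c' \is Num.real ->
  (forall i j, `|(a - c%:M - (b - c'%:M)) i j| <= e) ->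
  forall i j, `|(truncmx a c - truncmx b c') i j| <= n%:R * e.
Proof.
move=> ha hb cr cr' le_e i j.
have [p' [pp' pe e1 e2]] := truncmx_decomp ha cr.
have [q' [pq' qe e3 e4]] := truncmx_decomp hb cr'.
have e0 : 0 <= e by apply: le_trans (le_e i j).
have := trace_contract (psd_truncmx a c) pp' (psd_truncmx b c') pq' e1 e2 e3 e4.
rewrite pe qe !trace_adj => h.
rewrite -(@ler_pXn2r _ 2) ?nnegrE ?mulr_ge0 //.
apply: (@le_trans _ _ (\sum_i \sum_j `|(truncmx a c - truncmx b c') i j| ^+ 2)).
  rewrite (bigD1 i) //= (bigD1 j) //= -addrA lerDl addr_ge0 ?sumr_ge0 // => *.
    by rewrite exprn_ge0.
  by rewrite sumr_ge0 // => *; rewrite exprn_ge0.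
apply: (le_trans h); apply: (@le_trans _ _ (\sum_(i < n) \sum_(j < n) e ^+ 2)).
  by do 2 (apply: ler_sum => ? _); rewrite lerXn2r ?nnegrE.
rewrite !sumr_const !card_ord -mulrnA exprMn -[X in X <= _]mulr_natl.
by rewrite natrM expr2.
Qed.

Lemma rank_truncmx n (a : 'M[C]_n) c : a \is hermsymmx -> c \is Num.real ->
  \rank (truncmx a c) = #|[set i | (c < spectral_diag a 0 i)%R]|.
Proof.
move=> ha cr; rewrite rank_specmx ?spectral_unitarymx //.
apply: eq_card => i; rewrite !inE mxE posr_neq0 ?subr_gt0 // realB //.
by have /mxOverP := hermitian_spectral_diag_real ha.
Qed.

Lemma truncmx0 n (a : 'M[C]_n) : psd a -> truncmx a 0 = a.
Proof.
move=> pa; have [ha _] := pa; rewrite {2}(specmx_spectral ha); congr specmx.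
by apply/rowP => i; rewrite mxE subr0 posr_id // psd_spectral_diag.
Qed.

Lemma rank_psd n (a : 'M[C]_n) : psd a ->
  \rank a = #|[set i | (0 < spectral_diag a 0 i)%R]|.
Proof. by move=> pa; have [ha _] := pa; rewrite -rank_truncmx // truncmx0. Qed.

Lemma qformD n (a b : 'M[C]_n) w : qform (a + b) w = qform a w + qform b w.
Proof. by rewrite /qform mulmxDr mulmxDl mxE. Qed.

Lemma hermsymmxB n (a b : 'M[C]_n) :
  a \is hermsymmx -> b \is hermsymmx -> a - b \is hermsymmx.
Proof. by rewrite !hermsymmxE !raddfB /= => /eqP <- /eqP <-. Qed.

Lemma psdD n (a b : 'M[C]_n) : psd a -> psd b -> psd (a + b).
Proof.
move=> [ha qa] [hb qb]; split=> [|w]; last by rewrite qformD addr_ge0.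
by move: ha hb; rewrite !hermsymmxE !raddfD /= => /eqP <- /eqP <-.
Qed.

Lemma psdZ n c (a : 'M[C]_n) : 0 <= c -> psd a -> psd (c *: a).
Proof.
move=> c0 [ha qa]; split=> [|w].
  have cJ : conjC c = c by apply/CrealP/ger0_real.
  by move: ha; rewrite !hermsymmxE linearZ /= map_mxZ /= cJ => /eqP <-.
rewrite /qform -scalemxAr -scalemxAl mxE; apply: mulr_ge0 => //; exact: qa.
Qed.

Lemma scalar_hermsymmx n (c : C) : c \is Num.real -> (c%:M : 'M[C]_n) \is hermsymmx.
Proof.
move=> cr; rewrite hermsymmxE tr_scalar_mx map_scalar_mx /=.
by have /CrealP -> := cr.
Qed.

Lemma qform_real n (a : 'M[C]_n) w : a \is hermsymmx -> qform a w \is Num.real.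
Proof.
move=> ha; rewrite (specmx_spectral ha) qform_specmx rpred_sum // => i _.
rewrite rpredM ?rpredX ?normr_real //.
by have /mxOverP := hermitian_spectral_diag_real ha.
Qed.

Lemma qform_scalar n (c : C) (w : 'rV[C]_n) :
  qform c%:M w = c * \sum_i `|w 0 i| ^+ 2.
Proof.
rewrite /qform mul_mx_scalar -scalemxAl mxE; congr (_ * _).
by rewrite mxE; apply: eq_bigr => i _; rewrite !mxE normCK.
Qed.

Lemma qform_bound n (a : 'M[C]_n) (e : C) w : (forall i j, `|a i j| <= e) ->
  `|qform a w| <= n%:R * e * \sum_i `|w 0 i| ^+ 2.
Proof.
move=> le_e.
have -> : qform a w = \sum_j \sum_i w 0 i * a i j * (w 0 j)^*.
  rewrite /qform mxE; apply: eq_bigr => j _; rewrite !mxE mulr_suml.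
  by [].
(* Arithmetic-geometric mean inequality on each product of two coordinates. *)
apply: (@le_trans _ _ (\sum_j \sum_i e * ((`|w 0 i| ^+ 2 + `|w 0 j| ^+ 2) / 2))).
  apply: (le_trans (ler_norm_sum _ _ _)); apply: ler_sum => j _.
  apply: (le_trans (ler_norm_sum _ _ _)); apply: ler_sum => i _.
  rewrite !normrM norm_conjC mulrAC mulrC.
  apply: ler_pM; rewrite ?mulr_ge0 //.
  rewrite ler_pdivlMr // -subr_ge0.
  have -> : `|w 0 i| ^+ 2 + `|w 0 j| ^+ 2 - `|w 0 i| * `|w 0 j| * 2 =
    (`|w 0 i| - `|w 0 j|) ^+ 2 by ring.
  by rewrite real_exprn_even_ge0 // realB.
have -> : \sum_j \sum_i e * ((`|w 0 i| ^+ 2 + `|w 0 j| ^+ 2) / 2) =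
  e / 2 * (\sum_j \sum_i (`|w 0 i| ^+ 2 + `|w 0 j| ^+ 2)).
  rewrite mulr_sumr; apply: eq_bigr => j _; rewrite mulr_sumr; apply: eq_bigr => i _.
  by rewrite [_ / 2]mulrC !mulrA.
set S := \sum_i `|w 0 i| ^+ 2.
have -> : \sum_j \sum_i (`|w 0 i| ^+ 2 + `|w 0 j| ^+ 2) = n%:R * S *+ 2.
  under eq_bigr do rewrite big_split sumr_const card_ord /=.
  by rewrite big_split sumr_const card_ord /= sumrMnl -mulr2n mulr_natl.
suff -> : e / 2 * (n%:R * S *+ 2) = n%:R * e * S by [].
by field.
Qed.

(* [is_topeig a k c]: counting with multiplicity, [c] is the [k]-th largest
   eigenvalue of [a], the largest one having index 0. *)
Definition is_topeig n (a : 'M[C]_n) (k : nat) (c : C) :=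
  [/\ c \is Num.real,
    forall x, x \is Num.real ->
      (c <= x) = (#|[set i | (x < spectral_diag a 0 i)%R]| <= k)%N &
    forall x, x \is Num.real ->
      (x <= c) = (k < #|[set i | (x <= spectral_diag a 0 i)%R]|)%N].

(** Shifting [a] by [x + e] and [b] by [x] reduces the count to positive eigenvalues, where
    [specmx_monotone] applies. *)
Lemma count_monotone n (a b : 'M[C]_n) (e x : C) :
  a \is hermsymmx -> b \is hermsymmx -> e \is Num.real -> x \is Num.real ->
  (forall w, qform a w <= qform b w + e * \sum_i `|w 0 i| ^+ 2) ->
  (#|[set i | (x + e < spectral_diag a 0 i)%R]| <=
   #|[set i | (x < spectral_diag b 0 i)%R]|)%N.
Proof.
move=> ha hb er xr le_ab.
have Uu := spectral_unitarymx a; have Vu := spectral_unitarymx b.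
have := @specmx_monotone _ _ _ _ (spectral_diag a - const_mx (x + e))
  (spectral_diag b - const_mx x) Uu Vu.
have -> : [set i | (0 < (spectral_diag a - const_mx (x + e)) 0 i)%R] =
    [set i | (x + e < spectral_diag a 0 i)%R].
  by apply/setP => i; rewrite !inE !mxE subr_gt0.
have -> : [set i | (0 < (spectral_diag b - const_mx x) 0 i)%R] =
    [set i | (x < spectral_diag b 0 i)%R].
  by apply/setP => i; rewrite !inE !mxE subr_gt0.
apply.
  apply/mxOverP => i j; rewrite !mxE realB //.
  by have /mxOverP := hermitian_spectral_diag_real hb.
move=> w; rewrite !specmxD !specmxN !specmx_const // -!specmx_spectral //.
rewrite -!raddfN !qformD !qform_scalar !mulNr mulrDl opprD addrA lerBlDr.
by rewrite lerBlDr addrAC subrK.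
Qed.

(** The rank of a positive semidefinite matrix is its number of positive eigenvalues, which cannot
    drop when the form increases. *)
Lemma rank_psdD n (a b : 'M[C]_n) :
  psd a -> psd b -> (\rank a <= \rank (a + b)%R)%N.
Proof.
move=> pa pb; have pab := psdD pa pb; have [ha _] := pa; have [hab _] := pab.
rewrite !rank_psd //.
have := @count_monotone _ a (a + b) 0 0 ha hab (real0 _) (real0 _).
by rewrite addr0; apply => w; rewrite mul0r addr0 qformD lerDl; case: pb.
Qed.

(** For [c != 1] the summand [(1 - c) *: a] already has the rank of [a], and adding a positive
    semidefinite matrix does not lower it. *)
Lemma psd_convex n (a b : 'M[C]_n) (c : C) (l : nat) : psd a -> psd b ->
  0 <= c <= 1 -> (l <= \rank a)%N -> (l <= \rank b)%N ->
  psd (a + c *: (b - a)) /\ (l <= \rank (a + c *: (b - a))%R)%N.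
Proof.
move=> pa pb /andP[c0 c1] la lb.
have -> : a + c *: (b - a) = (1 - c) *: a + c *: b.
  by rewrite scalerBl scale1r scalerBr addrA addrAC.
have pZa : psd ((1 - c) *: a) by apply: psdZ; rewrite ?subr_ge0.
have pZb := psdZ c0 pb; split; first exact: psdD.
have [->|c_neq1] := eqVneq c 1; first by rewrite subrr scale0r add0r scale1r.
apply: (leq_trans la); rewrite -(@mxrank_scale_nz _ _ _ (1 - c) a) ?rank_psdD //.
by rewrite subr_eq0 eq_sym.
Qed.

(** At most [k] eigenvalues of [b] exceed [c']. The form of [a - b] is at most [n%:R * e] times the
    squared norm, so at most [k] eigenvalues of [a] exceed [c' + n%:R * e]. *)
Lemma weyl n (a b : 'M[C]_n) k (c c' e : C) :
  a \is hermsymmx -> b \is hermsymmx -> is_topeig a k c -> is_topeig b k c' ->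
  (forall i j, `|(a - b) i j| <= e) -> (0 < n)%N -> c <= c' + n%:R * e.
Proof.
move=> ha hb [cr cP _] [cr' cP' _] le_e n0.
have er : e \is Num.real.
  exact/ger0_real/(le_trans _ (le_e (Ordinal n0) (Ordinal n0))).
have ner : n%:R * e \is Num.real by rewrite realM // realn.
rewrite cP ?realD //; have := lexx c'; rewrite {1}cP' //; apply: leq_trans.
apply: count_monotone => // w; rewrite addrC -lerBlDr.
have -> : a = (a - b) + b by rewrite subrK.
rewrite qformD addrK; apply: le_trans (qform_bound w le_e).
by apply/real_ler_norm/qform_real/hermsymmxB.
Qed.

End PositivePart.

(** * Bounded charts for matrices of given rank *)

Section Chart.
Variable C : numClosedFieldType.
Implicit Types (n : nat).

Lemma unitmx_maximal_rowsub m p (w : 'M[C]_(m, p)) : row_full w ->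
  exists f : {ffun 'I_p -> 'I_m},
    \det (rowsub f w) != 0 /\
    forall g : {ffun 'I_p -> 'I_m}, `|\det (rowsub g w)| <= `|\det (rowsub f w)|.
Proof.
move=> wfull; pose f0 := [ffun i => fullrankfun wfull i].
have f0n0 : \det (rowsub f0 w) != 0.
  have -> : rowsub f0 w = rowsub (fullrankfun wfull) w.
    by apply/matrixP => i j; rewrite !mxE ffunE.
  by rewrite -unitfE -unitmxE fullrowsub_unit.
have [f _ fmax] := @real_arg_maxP C _ f0 predT
  (fun g : {ffun 'I_p -> 'I_m} => `|\det (rowsub g w)|) isT (fun _ _ => normr_real _).
exists f; split => [|g]; last exact: fmax.
by rewrite -normr_gt0; apply: lt_le_trans (fmax f0 isT); rewrite normr_gt0.
Qed.

(* The rows in [S] are those of a minor of maximal modulus in a column basis of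
   [M]; by Cramer's rule this bounds [alpha] by 1. *)
Lemma rank_chart n (M : 'M[C]_n) : exists (S : {set 'I_n}) (alpha : 'M[C]_n),
  [/\ #|S| = \rank M, forall i j, j \notin S -> alpha i j = 0,
      forall i j, i \in S -> alpha i j = (i == j)%:R,
      forall i j, `|alpha i j| <= 1 & M = alpha *m M].
Proof.
set p := \rank M; pose w := col_base M.
have [f [fn0 fmax]] := unitmx_maximal_rowsub (col_base_full M).
rewrite -/w in fn0 fmax; pose B := rowsub f w.
have Bu : B \in unitmx by rewrite unitmxE unitfE.
have finj : injective f.
  move=> i j fij; apply/eqP; apply: contraNT fn0 => ij.
  by rewrite (determinant_alternate ij) // => k; rewrite !mxE fij.
(* The column basis is renormalised to be the identity on the rows chosen by [f]. *)
pose beta := w *m invmx B.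
have betaf i j : beta (f i) j = (i == j)%:R.
  have -> : beta (f i) j = (B *m invmx B) i j.
    by rewrite !mxE; apply: eq_bigr => k _; rewrite [in RHS]mxE.
  by rewrite mulmxV // mxE.
have beta1 i j : `|beta i j| <= 1.
  (* Replacing the [j]-th chosen row by row [i] multiplies the minor by [beta i j]. *)
  pose g := [ffun k => if k == j then i else f k].
  have -> : beta i j = \det (rowsub g w) / \det B.
    rewrite /beta /invmx Bu -scalemxAr mxE mulrC; congr (_ / _).
    rewrite (expand_det_row _ j) mxE; apply: eq_bigr => k _.
    rewrite !mxE ffunE eqxx; congr (_ * (_ * \det _)).
    apply/matrixP => a b; rewrite !mxE ffunE.
    by rewrite eq_sym (negbTE (neq_lift _ _)).
  by rewrite normrM normfV ler_pdivrMr ?normr_gt0 // mul1r fmax.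
(* The columns of [beta] move to the indices [f j] and the other columns are zero, so [alpha *m M]
   reads only the chosen rows of [M]. *)
pose alpha := \matrix_(i, a) \sum_j beta i j * (a == f j)%:R.
have alphaf i j : alpha i (f j) = beta i j.
  rewrite mxE (bigD1 j) //= eqxx mulr1 big1 ?addr0 // => k kj.
  by rewrite (inj_eq finj) eq_sym (negbTE kj) mulr0.
have alpha0 i a : a \notin [set f j | j : 'I_p] -> alpha i a = 0.
  move=> aS; rewrite mxE big1 // => j _; case: eqP => [ea|]; last by rewrite mulr0.
  by case/negP: aS; rewrite ea imset_f.
exists [set f j | j : 'I_p], alpha; split=> //.
- by rewrite card_imset // card_ord.
- move=> i a /imsetP[j _ ->]; case: (boolP (a \in [set f j | j : 'I_p])).
    by case/imsetP => k _ ->; rewrite alphaf betaf (inj_eq finj).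
  move=> aS; rewrite alpha0 //; case: eqP => // ea.
  by case/negP: aS; rewrite -ea imset_f.
- move=> i a; case: (boolP (a \in [set f j | j : 'I_p])).
    by case/imsetP => k _ ->; rewrite alphaf.
  by move=> aS; rewrite alpha0 // normr0 ler01.
- have -> : alpha = beta *m rowsub f 1%:M.
    apply/matrixP => i a; rewrite !mxE; apply: eq_bigr => j _.
    by rewrite !mxE eq_sym.
  rewrite -mulmxA mul_rowsub_mx mul1mx.
  have -> : rowsub f M = B *m row_base M.
    by rewrite mul_rowsub_mx mulmx_base.
  by rewrite mulmxA mulmxKV // mulmx_base.
Qed.

End Chart.

(** * Lipschitz images of low-dimensional boxes *)

Section Pigeonhole.
Variable R : archiRealFieldType.

Lemma expn_lt_self (c s q : nat) : (s < q)%N ->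
  exists N, (0 < N)%N /\ (c * N ^ s < N ^ q)%N.
Proof.
move=> sq; exists c.+1; split=> //.
apply: (@leq_trans (c.+1 ^ s.+1)); last by rewrite leq_pexp2l.
by rewrite expnS ltn_mul2r expn_gt0 ltnS leqnn.
Qed.

(* A Lipschitz image of boxes of dimension [s] misses some point of a fine grid
   in dimension [#|Q| > s]: otherwise two distinct grid points would have
   parameters in a common cell. *)
Lemma lipschitz_avoid (I P Q : finType) (D : I -> {set P}) (s : nat)
    (Psi : I -> (P -> R) -> Q -> R) (K L delta : R) :
  (s < #|Q|)%N -> (forall i, #|D i| <= s)%N -> 0 <= K -> 0 <= L -> 0 < delta ->
  (forall i p p' e, (forall a, `|p a| <= K) -> (forall a, `|p' a| <= K) ->
     (forall a, `|p a - p' a| <= e) -> forall b, `|Psi i p b - Psi i p' b| <= L * e) ->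
  exists v : Q -> R, (forall b, 0 <= v b <= delta) /\
    forall i p, (forall a, `|p a| <= K) -> (forall a, a \notin D i -> p a = 0) ->
      exists b, Psi i p b != v b.
Proof.
move=> sQ Ds K0 L0 d0 lip; apply: contrapT => noav.
(* Cells will have side [1 / (N * c0)]. Since [c0] exceeds [L / delta], two points of one cell have
   images closer than the grid step [delta / N]; since [c1] exceeds [2 * K * c0], [N * c1] cells
   cover the interval from [- K] to [K]. *)
pose c0 := (Num.bound (L / delta)).
have c0P : L / delta < c0%:R by rewrite archi_boundP // divr_ge0 // ltW.
have c0_gt0 : 0 < c0%:R :> R by apply: le_lt_trans c0P; rewrite divr_ge0 // ltW.
pose c1 := Num.bound (2 * K * c0%:R).
have c1P : 2 * K * c0%:R < c1%:R by rewrite archi_boundP // !mulr_ge0 // ltW.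
have c1_gt0 : (0 < c1)%N.
  by rewrite -(ltr_nat R); apply: le_lt_trans c1P; rewrite !mulr_ge0 // ltW.
(* With this [N] the [N ^ #|Q|] grid points outnumber all the cells. *)
have [N [N0 ltN]] := expn_lt_self (#|I| * c1 ^ s) sQ.
have NR : 0 < N%:R :> R by rewrite ltr0n.
pose v (z : {ffun Q -> 'I_N}) (b : Q) : R := delta * (z b)%:R / N%:R.
have hit z : exists u : I * (P -> R), [/\ forall a, `|u.2 a| <= K,
    forall a, a \notin D u.1 -> u.2 a = 0 & forall b, Psi u.1 u.2 b = v z b].
  apply: contrapT => nohit; apply: noav; exists (v z); split.
    move=> b; rewrite /v !mulr_ge0 ?invr_ge0 ?ler0n ?(ltW d0) //=.
    by rewrite ler_pdivrMr // ler_pM2l // ler_nat ltnW.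
  move=> i p pK pD; apply: contrapT => noex; apply: nohit; exists (i, p).
  split=> // b; apply/eqP; apply: contrapT => /negP nb; apply: noex.
  by exists b.
have [u uP] := choice hit.
pose T : R := N%:R * c0%:R.
have T0 : 0 < T by rewrite mulr_gt0.
pose m := (N * c1).-1.
have mE : m.+1 = (N * c1)%N by rewrite prednK // muln_gt0 N0.
(* Coordinates outside [D] get the default cell, so at most [s] of them contribute to the count. *)
pose cell z : {ffun P -> 'I_m.+1} :=
  [ffun a => if a \in D (u z).1 then inord (Num.truncn (((u z).2 a + K) * T)) else ord0].
pose psi z := ((u z).1, cell z).
have ge0 z a : 0 <= ((u z).2 a + K) * T.
  have [/(_ a) + _ _] := uP z; rewrite ler_norml => /andP[h _].
  by apply: mulr_ge0; [rewrite -lerBlDr sub0r | exact: ltW].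
have psi_inj : injective psi.
  move=> z z' []; rewrite /psi => ei ec; apply/ffunP => b; apply/val_inj/eqP.
  have close a : `|(u z).2 a - (u z').2 a| <= T^-1.
    have [aK aD _] := uP z; have [aK' aD' _] := uP z'.
    have [aDi|aDi] := boolP (a \in D (u z).1); last first.
      by rewrite aD // aD' -?ei // subr0 normr0 invr_ge0 ltW.
    move/ffunP/(_ a): ec; rewrite !ffunE -ei aDi => /(congr1 val) /=.
    have small w : (Num.truncn (((u w).2 a + K) * T) < m.+1)%N.
      rewrite truncn_lt_nat // mE; have [/(_ a) + _ _] := uP w.
      rewrite ler_norml => /andP[_ h].
      have : ((u w).2 a + K) * T <= 2 * K * T.
        by rewrite ler_pM2r // mulrDl mul1r lerD2r.
      move/le_lt_trans; apply; rewrite /T natrM mulrCA ltr_pM2l //.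
    rewrite !inordK // => et.
    have /andP[l1 r1] := truncn_itv (ge0 z a).
    have /andP[l2 r2] := truncn_itv (ge0 z' a).
    rewrite -et in l2 r2; rewrite -[X in _ <= X]mul1r ler_pdivlMr //.
    rewrite -[T in _ * T]ger0_norm ?(ltW T0) // -normrM ler_norml.
    move: l1 r1 l2 r2; rewrite -[(_.+1)%:R]natr1.
    set t := (_%:R); set x := (u z).2 a; set y := (u z').2 a; nra.
  have [aK _ az] := uP z; have [aK' _ az'] := uP z'.
  have := lip (u z).1 _ _ _ aK aK' close b; rewrite az {1}ei az' /v.
  rewrite -mulrBl -mulrBr normrM normrM (ger0_norm (ltW d0)).
  have -> : `|N%:R^-1| = N%:R^-1 :> R by rewrite ger0_norm // invr_ge0 ltW.
  move=> h.
  have {}h : `|(z b)%:R - (z' b)%:R| < 1 :> R.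
    have : delta * `|(z b)%:R - (z' b)%:R| / N%:R < delta / N%:R.
      apply: (le_lt_trans h); rewrite /T invfM mulrCA [in X in _ < X]mulrC.
      rewrite ltr_pM2l ?invr_gt0 //.
      by rewrite ltr_pdivrMr // mulrC -ltr_pdivrMr.
    by rewrite ltr_pM2r ?invr_gt0 // gtr_pMr.
  move: h; rewrite ltr_norml => /andP[h1 h2].
  rewrite eqn_leq -[(_ <= z' b)%N]ltnS -[(_ <= z b)%N]ltnS.
  by rewrite -!(ltr_nat R) -!natr1; apply/andP; split; lra.
pose E := [set x : I * {ffun P -> 'I_m.+1} | x.2 \in pffun_on ord0 (D x.1) predT].
have psiE : psi @: {ffun Q -> 'I_N} \subset E.
  apply/fintype.subsetP => _ /imsetP[z _ ->]; rewrite inE /=; apply/pffun_onP; split=> //.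
  by apply/fintype.subsetP => a; rewrite !inE ffunE; case: ifP; rewrite ?eqxx.
have := subset_leq_card psiE; rewrite card_imset // card_ffun card_ord.
have cardE : (#|E| <= #|I| * (N * c1) ^ s)%N.
  rewrite -sum1_card.
  rewrite (eq_bigl (fun x => true && (x.2 \in pffun_on ord0 (D x.1) predT)));
    last by move=> x; rewrite inE.
  rewrite -(pair_big_dep predT
    (fun i (x : {ffun P -> 'I_m.+1}) => x \in pffun_on ord0 (D i) predT)
    (fun _ _ => 1%N)) /=.
  rewrite -sum_nat_const; apply: leq_sum => i _.
  rewrite sum1_card card_pffun_on card_ord mE leq_pexp2l // muln_gt0 N0 //.
move=> /leq_trans /(_ cardE); rewrite expnMn mulnCA mulnC leqNgt mulnC mulnCA.
by rewrite mulnA mulnAC -mulnA mulnA ltN.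
Qed.

End Pigeonhole.

(** * Ordered eigenvalues and multiplicity *)

Section RankGap.
Variable C : numClosedFieldType.

(** At most [j] eigenvalues exceed [c], as [c' <= c], and at most [n - k.+1] lie below [c], which
    has index [k]; only these contribute to the rank. *)
Lemma rank_is_topeig n (a : 'M[C]_n) (j k : nat) (c c' : C) :
  a \is hermsymmx -> is_topeig a j c' -> is_topeig a k c -> c' <= c ->
  (\rank (a - c%:M)%R + k.+1 <= j + n)%N.
Proof.
move=> ha [cr' jP _] [cr _ kP] le_cc.
have := le_cc; rewrite jP // => gtc; have := lexx c; rewrite {1}kP // => gec.
have -> : \rank (a - c%:M) = #|[set i | (spectral_diag a 0 i != c)%R]|.
  have Uu := spectral_unitarymx a.
  rewrite {1}(specmx_spectral ha) -(specmx_const _ Uu) -specmxN -specmxD.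
  rewrite rank_specmx //; apply: eq_card => i; rewrite !inE !mxE.
  by rewrite subr_eq0.
have -> : [set i | (spectral_diag a 0 i != c)%R] =
   [set i | (c < spectral_diag a 0 i)%R] :|: ~: [set i | (c <= spectral_diag a 0 i)%R].
  apply/setP => i; rewrite !inE lt_def eq_sym.
  have dr : spectral_diag a 0 i \is Num.real.
    by have /mxOverP := hermitian_spectral_diag_real ha.
  case: (real_ltgtP cr dr) => //=.
have := cardsC [set i | (c <= spectral_diag a 0 i)%R]; rewrite card_ord.
have := leq_card_setU [set i | (c < spectral_diag a 0 i)%R]
  (~: [set i | (c <= spectral_diag a 0 i)%R]).
case=> + _; move: gtc gec.
move: #|_ :|: _| #|~: _| #|_| #|_| => *; lia.
Qed.

End RankGap.

Section TopEigenvalue.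
Variable R : realType.
Local Notation C := (Cplx R).

(* Meaningful for [k < n] only. *)
Definition topeig n (a : 'M[C]_n) (k : nat) : R :=
  nth 0 (sort <=%O [seq complex.Re (spectral_diag a 0 i) | i <- enum 'I_n]) (n - k.+1).

Lemma topeig_is_topeig n (a : 'M[C]_n) k : a \is hermsymmx -> (k < n)%N ->
  is_topeig a k (topeig a k)%:C%C.
Proof.
move=> ha kn; set s := [seq complex.Re (spectral_diag a 0 i) | i <- enum 'I_n].
pose d i : R := complex.Re (spectral_diag a 0 i).
have dE i : spectral_diag a 0 i = (d i)%:C%C.
  have /mxOverP /(_ 0 i) dr := hermitian_spectral_diag_real ha.
  by rewrite /d RRe_real.
have ss : sorted <=%O (sort <=%O s) by apply: sort_sorted; exact: le_total.
have sz : size (sort <=%O s) = n by rewrite size_sort size_map size_enum_ord.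
have cnt (p : pred R) : count p (sort <=%O s) = #|[set i | p (d i)]|.
  rewrite count_sort count_map -sum1_count -sum1_card big_enum_cond.
  by apply: eq_bigl => i; rewrite !inE.
have cntC (p q : pred R) : (forall x, q x = ~~ p x) ->
   (#|[set i | p (d i)]| + #|[set i | q (d i)]|)%N = n.
  move=> pq; rewrite -[RHS]card_ord -(cardsC [set i | p (d i)]); congr addn.
  by apply: eq_card => i; rewrite !inE pq.
have cr (x : R) : (x%:C%C : C) \is Num.real by apply/complex_realP; exists x.
(* In increasing order the eigenvalue of index [k] has position [n - k.+1]; [h1] and [h2] turn
   complementary counts into bounds on this position. *)
have h1 A B : (A + B = n -> k < B -> A <= n - k.+1 < n)%N by lia.
have h2 A B : (A + B = n -> B <= k -> n - k.+1 < A)%N by lia.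
split; first exact: cr.
- move=> x /complex_realP[{}x ->]; rewrite lecR.
  have -> : #|[set i | (x%:C%C < spectral_diag a 0 i)%R]| = #|[set i | (x < d i)%R]|.
    by apply: eq_card => i; rewrite !inE dE ltcR.
  have := cntC (<= x) (> x) (fun y => ltNge _ _); rewrite -!cnt /= => cxs.
  apply/idP/idP => [le_x|lt_k].
    rewrite leqNgt; apply/negP => gt_k; move: le_x; rewrite leNgt => /negP; apply.
    by apply: nth_count_gt => //; rewrite sz; exact: h1 cxs gt_k.
  by apply: nth_count_le => //; exact: h2 cxs lt_k.
- move=> x /complex_realP[{}x ->]; rewrite lecR.
  have -> : #|[set i | (x%:C%C <= spectral_diag a 0 i)%R]| = #|[set i | (x <= d i)%R]|.
    by apply: eq_card => i; rewrite !inE dE lecR.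
  have := cntC (< x) (>= x) (fun y => leNgt _ _); rewrite -!cnt /= => cxs.
  apply/idP/idP => [le_x|lt_k].
    rewrite ltnNge; apply/negP => gt_k; move: le_x; rewrite leNgt => /negP; apply.
    by apply: nth_count_lt => //; exact: h2 cxs gt_k.
  by apply: nth_count_ge => //; rewrite sz; exact: h1 cxs lt_k.
Qed.

End TopEigenvalue.

(** * Lipschitz functions and Hermitian coordinates *)

Section Lipschitz.
Variables (R : realType) (P : Type) (K : R).
Implicit Types phi psi : (P -> R) -> R.

Definition box (p : P -> R) := forall a, `|p a| <= K.

(** The sup distance enters through a common bound [e] on the coordinates. Restricting to the box
    keeps products Lipschitz. *)
Definition lip phi := exists L : R, 0 <= L /\ forall p p' e, box p -> box p' ->
  (forall a, `|p a - p' a| <= e) -> `|phi p - phi p'| <= L * e.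

Lemma lip_const c : lip (fun=> c).
Proof. by exists 0; split=> // *; rewrite subrr normr0 mul0r. Qed.

Lemma lip_proj a : lip (fun p => p a).
Proof. by exists 1; split=> // p p' e _ _ h; rewrite mul1r. Qed.

Lemma lipD phi psi : lip phi -> lip psi -> lip (fun p => phi p + psi p).
Proof.
move=> [L [L0 hL]] [M [M0 hM]]; exists (L + M); split=> [|p p' e bp bp' h].
  by rewrite addr_ge0.
rewrite opprD addrACA mulrDl (le_trans (ler_normD _ _)) // lerD //.
  exact: hL.
exact: hM.
Qed.

Lemma lipN phi : lip phi -> lip (fun p => - phi p).
Proof.
move=> [L [L0 hL]]; exists L; split=> // p p' e bp bp' h.
by rewrite -opprD normrN hL.
Qed.

(** On the box both factors are bounded, by their value at the origin plus [K] times their Lipschitz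
    constant. *)
Lemma lipM phi psi : 0 <= K -> lip phi -> lip psi -> lip (fun p => phi p * psi p).
Proof.
move=> K0 [L [L0 hL]] [M [M0 hM]].
have box0 : box (fun=> 0) by move=> a; rewrite normr0.
have bdd (chi : (P -> R) -> R) (N : R) : (forall p p' e, box p -> box p' ->
     (forall a, `|p a - p' a| <= e) -> `|chi p - chi p'| <= N * e) ->
   forall p, box p -> `|chi p| <= N * K + `|chi (fun=> 0)|.
  move=> hN p bp; rewrite -[X in `|X|](subrK (chi (fun=> 0))).
  rewrite (le_trans (ler_normD _ _)) // lerD2r hN // => a.
  by rewrite subr0.
set Bp := L * K + `|phi (fun=> 0)|; set Bq := M * K + `|psi (fun=> 0)|.
exists (Bp * M + L * Bq); split=> [|p p' e bp bp' h].
  by rewrite addr_ge0 ?mulr_ge0 // addr_ge0 // mulr_ge0.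
have -> : phi p * psi p - phi p' * psi p' =
   phi p * (psi p - psi p') + (phi p - phi p') * psi p' by ring.
rewrite (le_trans (ler_normD _ _)) // !normrM mulrDl -mulrA -[L * Bq]mulrC -mulrA lerD //.
  by rewrite ler_pM //; [exact: bdd hL _ bp | exact: hM].
by rewrite mulrC ler_pM //; [exact: bdd hM _ bp' | exact: hL].
Qed.

Local Notation C := (Cplx R).

Definition lipC (f : (P -> R) -> C) :=
  lip (fun p => complex.Re (f p)) /\ lip (fun p => complex.Im (f p)).

Lemma lipC_const c : lipC (fun=> c).
Proof. by split; exact: lip_const. Qed.

Lemma lipC_D f g : lipC f -> lipC g -> lipC (fun p => f p + g p).
Proof.
move=> [fr fi] [gr gi]; split.
  by rewrite (_ : (fun _ => _) = fun p => complex.Re (f p) + complex.Re (g p));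
    [exact: lipD | apply: funext => p; rewrite raddfD].
by rewrite (_ : (fun _ => _) = fun p => complex.Im (f p) + complex.Im (g p));
    [exact: lipD | apply: funext => p; rewrite raddfD].
Qed.

Lemma ReM (x y : C) : complex.Re (x * y) =
  complex.Re x * complex.Re y - complex.Im x * complex.Im y.
Proof. by case: x y => [a b] [c d]. Qed.

Lemma ImM (x y : C) : complex.Im (x * y) =
  complex.Re x * complex.Im y + complex.Im x * complex.Re y.
Proof. by case: x y => [a b] [c d]. Qed.

Lemma lipC_M f g : 0 <= K -> lipC f -> lipC g -> lipC (fun p => f p * g p).
Proof.
move=> K0 [fr fi] [gr gi]; split.
  rewrite (_ : (fun _ => _) = fun p => complex.Re (f p) * complex.Re (g p)
      + - (complex.Im (f p) * complex.Im (g p))).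
    by apply: lipD; [|apply: lipN]; exact: lipM.
  by apply: funext => p; rewrite ReM.
rewrite (_ : (fun _ => _) = fun p => complex.Re (f p) * complex.Im (g p)
      + complex.Im (f p) * complex.Re (g p)).
  by apply: lipD; exact: lipM.
by apply: funext => p; rewrite ImM.
Qed.

Lemma lipC_conj f : lipC f -> lipC (fun p => (f p)^* )%R.
Proof.
move=> [fr fi]; split.
  rewrite (_ : (fun _ => _) = fun p => complex.Re (f p)) //.
  by apply: funext => p; case: (f p).
rewrite (_ : (fun _ => _) = fun p => - complex.Im (f p)); first exact: lipN.
by apply: funext => p; case: (f p).
Qed.

Lemma lipC_sum (I : Type) (r : seq I) (f : I -> (P -> R) -> C) :
  (forall i, lipC (f i)) -> lipC (fun p => \sum_(i <- r) f i p).
Proof.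
move=> h; elim: r => [|i r IH].
  rewrite (_ : (fun _ => _) = fun=> 0); first exact: lipC_const.
  by apply: funext => p; rewrite big_nil.
rewrite (_ : (fun _ => _) = fun p => f i p + \sum_(j <- r) f j p).
  exact: lipC_D.
by apply: funext => p; rewrite big_cons.
Qed.

End Lipschitz.

(** * Real coordinates on Hermitian matrices *)

Section HermitianCoordinates.
Variable R : realType.
Local Notation C := (Cplx R).

(* Applied entrywise, [rcoord] is a real-linear bijection from Hermitian matrices
   to real matrices; [herm] is its inverse. *)
Definition rcoord (z : C) : R := complex.Re z + complex.Im z.

Definition herm n (Y : 'M[R]_n) : 'M[C]_n :=
  \matrix_(i, j) (((Y i j + Y j i) / 2) +i* ((Y i j - Y j i) / 2))%C.

Lemma hermK n (Y : 'M[R]_n) i j : rcoord (herm Y i j) = Y i j.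
Proof. by rewrite mxE /rcoord /=; field. Qed.

(** The real part of [b] is symmetric and its imaginary part antisymmetric, so their sum determines
    both. *)
Lemma rcoordK n (b : 'M[C]_n) : b \is hermsymmx ->
  herm (\matrix_(i, j) rcoord (b i j)) = b.
Proof.
rewrite hermsymmxE => /eqP hb; apply/matrixP => i j; rewrite !mxE /rcoord.
have : b j i = ((b i j)^* )%R by rewrite {1}hb !mxE.
case: (b i j) => x y -> /=; apply/eqP; rewrite eq_complex /=.
by apply/andP; split; apply/eqP; field.
Qed.

Lemma herm_hermsymmx n (Y : 'M[R]_n) : herm Y \is hermsymmx.
Proof.
rewrite hermsymmxE; apply/eqP/matrixP => i j; rewrite !mxE; apply/eqP.
by rewrite eq_complex /=; apply/andP; split; apply/eqP; field.
Qed.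

Lemma hermD n (Y Z : 'M[R]_n) : herm (Y + Z) = herm Y + herm Z.
Proof.
apply/matrixP => i j; rewrite !mxE; apply/eqP.
by rewrite eq_complex /=; apply/andP; split; apply/eqP; field.
Qed.

Lemma herm_norm n (Y : 'M[R]_n) e i j : (forall i j, `|Y i j| <= e) ->
  `|herm Y i j| <= (2 * e)%:C%C.
Proof.
move=> le_e; rewrite mxE.
apply: (@le_trans _ _ (`|(((Y i j + Y j i) / 2)%:C%C : C)| +
  `|(0 +i* ((Y i j - Y j i) / 2) : C)%C|)).
  apply: (le_trans _ (ler_normD _ _)).
  rewrite le_eqVlt; apply/orP; left; apply/eqP; congr `|_|; apply/eqP.
  by rewrite eq_complex /= addr0 add0r !eqxx.
rewrite !normc_def /= !expr0n /= addr0 add0r !sqrtr_sqr -rmorphD lecR /=.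
have := le_e i j; have := le_e j i; rewrite !ler_norml => /andP[a1 a2] /andP[a3 a4].
have -> : 2 * e = e + e by ring.
by apply: lerD; rewrite ler_norml; apply/andP; split; lra.
Qed.

Lemma rcoord_bound (z : C) e : `|z| <= e%:C%C -> `|rcoord z| <= 2 * e.
Proof.
rewrite normc_def lecR => h.
have -> : 2 * e = e + e by ring.
rewrite (le_trans (ler_normD _ _)) // lerD //; apply: le_trans h;
  rewrite -sqrtr_sqr ler_wsqrtr // ?lerDl ?lerDr sqr_ge0 //.
Qed.

Lemma Re_bound (z : C) e : `|z| <= e%:C%C -> `|complex.Re z| <= e.
Proof.
by rewrite normc_def lecR; apply: le_trans; rewrite -sqrtr_sqr ler_wsqrtr // lerDl sqr_ge0.
Qed.

Lemma Im_bound (z : C) e : `|z| <= e%:C%C -> `|complex.Im z| <= e.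
Proof.
by rewrite normc_def lecR; apply: le_trans; rewrite -sqrtr_sqr ler_wsqrtr // lerDr sqr_ge0.
Qed.

End HermitianCoordinates.

(** * Perturbation away from multiple eigenvalues *)

Section Perturbation.
Variable R : realType.
Local Notation C := (Cplx R).
Variables (n d : nat).
Local Notation param := (('I_n * 'I_n) + option 'I_d)%type.
Implicit Types (S : {set 'I_n}) (p : param -> R).

(* The cells in [S * S] hold the core; for [i] outside [S] and [j] in [S] the
   cells [(i, j)] and [(j, i)] hold the real and imaginary parts of the left
   factor; [None] holds the eigenvalue and [Some a] the point of the prism. *)
Definition chart_left S p : 'M[C]_n := \matrix_(i, j)
  if j \in S then (if i \in S then (i == j)%:R else (p (inl (i, j)) +i* p (inl (j, i)))%C)
  else 0.

Definition chart_core S p : 'M[C]_n := herm (\matrix_(i, j)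
  (if (i \in S) && (j \in S) then p (inl (i, j)) else 0)).

Definition chart S p : 'M[C]_n :=
  chart_left S p *m chart_core S p *m (chart_left S p)^t* + ((p (inr None))%:C%C)%:M.

Definition chart_support S : {set param} := [set a | match a with
  | inl (i, j) => (i \in S) || (j \in S) | inr _ => true end].

Lemma card_chart_support S : (#|chart_support S| + (n - #|S|) ^ 2 = n ^ 2 + d.+1)%N.
Proof.
have -> : (n - #|S| = #|~: S|)%N by rewrite -[X in (X - _)%N](card_ord n) -(cardsC S) addKn.
rewrite -mulnn -cardsX.
have -> : #|finset.setX (~: S) (~: S)| = #|~: chart_support S|.
  have inl_inj : injective (@inl ('I_n * 'I_n) (option 'I_d)) by move=> x y [].
  rewrite -(card_imset _ inl_inj); apply: eq_card => -[[i j]|o]; rewrite !inE.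
    by rewrite (mem_imset _ _ inl_inj) !inE /= negb_or.
  by apply/negbTE/negP => /imsetP[].
by rewrite cardsC card_sum card_prod card_option !card_ord mulnn.
Qed.

Lemma lipC_chart K S i j : 0 <= K -> lipC K (fun p => chart S p i j).
Proof.
move=> K0.
have lipl k l : lipC K (fun p => chart_left S p k l).
  rewrite (_ : (fun _ => _) = fun p => if l \in S then
     (if k \in S then (k == l)%:R else (p (inl (k, l)) +i* p (inl (l, k)))%C) else 0).
    case: (l \in S); last exact: lipC_const.
    case: (k \in S); first exact: lipC_const.
    by split=> /=; exact: lip_proj.
  by apply: funext => p; rewrite mxE.
have lipc k l : lipC K (fun p => chart_core S p k l).
  have lipY k' l' : lip K (fun p => if (k' \in S) && (l' \in S) then p (inl (k', l')) else 0).
    by case: (_ && _); [exact: lip_proj | exact: lip_const].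
  rewrite (_ : (fun _ => _) = fun p =>
     (((if (k \in S) && (l \in S) then p (inl (k, l)) else 0) +
       (if (l \in S) && (k \in S) then p (inl (l, k)) else 0)) * 2^-1
      +i* (((if (k \in S) && (l \in S) then p (inl (k, l)) else 0) +
       - (if (l \in S) && (k \in S) then p (inl (l, k)) else 0)) * 2^-1))%C).
    split=> /=; apply: lipM => //; try exact: lip_const.
      exact: lipD.
    by apply: lipD => //; exact: lipN.
  by apply: funext => p; rewrite !mxE.
rewrite (_ : (fun _ => _) = fun p =>
   \sum_l (\sum_k chart_left S p i k * chart_core S p k l) * (chart_left S p j l)^* +
   (i == j)%:R * (p (inr None))%:C%C).
  apply: lipC_D.
    apply: lipC_sum => l; apply: lipC_M => //; last exact: lipC_conj.
    by apply: lipC_sum => k; exact: lipC_M.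
  apply: lipC_M => //; first exact: lipC_const.
  by split=> /=; [exact: lip_proj | exact: lip_const].
apply: funext => p; rewrite mxE [X in _ + X]mxE mulr_natl; congr (_ + _).
rewrite mxE; apply: eq_bigr => l _; rewrite mxE; congr (_ * _).
by rewrite !mxE.
Qed.

(** For Hermitian [M], the relation [M = al *m M] of [rank_chart] and its adjoint give
    [M = al *m M *m al^t*]. The columns of [al] outside [S] vanish, so only the block of [M] on [S]
    enters, and it is stored in the core. *)
Lemma chart_surj (b : 'M[C]_n) (c B : R) (x : 'I_d -> R) :
  b \is hermsymmx -> 1 <= B -> (forall i j, `|(b - (c%:C%C)%:M) i j| <= B%:C%C) ->
  exists S p, [/\ #|S| = \rank (b - (c%:C%C)%:M),
    forall a, a \notin chart_support S -> p a = 0,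
    (forall ij, `|p (inl ij)| <= 2 * B) /\ p (inr None) = c,
    (fun a => p (inr (Some a))) = x &
    b = chart S p].
Proof.
move=> hb B1 bB; have [M ME] : exists M, M = b - (c%:C%C)%:M by eexists.
rewrite -!ME in bB *.
have hM : M \is hermsymmx.
  rewrite ME; apply: hermsymmxB => //; apply: scalar_hermsymmx.
  by apply/complex_realP; exists c.
have [S [al [cardS al0 al1 alB Mal]]] := rank_chart M.
pose M' : 'M[C]_n := \matrix_(i, j) if (i \in S) && (j \in S) then M i j else 0.
have hM' : M' \is hermsymmx.
  move: hM; rewrite !hermsymmxE => /eqP hM; apply/eqP/matrixP => i j; rewrite !mxE andbC.
  case: ifP => _; last by rewrite rmorph0.
  by rewrite {1}hM !mxE.
pose p (a : param) : R := match a with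
  | inl (i, j) => if i \in S then (if j \in S then rcoord (M i j) else complex.Im (al j i))
                  else (if j \in S then complex.Re (al i j) else 0)
  | inr None => c | inr (Some a) => x a end.
have leftE : chart_left S p = al.
  apply/matrixP => i j; rewrite mxE /=; case: (boolP (j \in S)) => [jS|/al0 ->//].
  case: (boolP (i \in S)) => [iS|iS]; first by rewrite al1.
  by case: (al i j).
have coreE : chart_core S p = M'.
  rewrite -[RHS](rcoordK hM') /chart_core; congr herm; apply/matrixP => i j.
  rewrite !mxE /=; case: (i \in S); case: (j \in S) => //=;
    by rewrite /rcoord addr0.
exists S, p; split=> //.
- move=> [[i j]|o]; rewrite inE // negb_or => /andP[/negbTE iS /negbTE jS].
  by rewrite /p iS jS.
- split=> // -[i j] /=.
  have B0 : 1 <= 2 * B by lra.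
  have al1B i' j' : `|al i' j'| <= (1 : R)%:C%C by apply: alB.
  case: ifP => _; case: ifP => _; rewrite ?normr0; try lra.
  + exact: rcoord_bound.
  + by apply: le_trans B0; exact: Im_bound.
  + by apply: le_trans B0; exact: Re_bound.
- rewrite /chart leftE coreE /=.
  suff -> : al *m M' *m al^t* = M by rewrite ME subrK.
  have alM (X Y : 'M[C]_n) : (forall k l, k \in S -> l \in S -> X k l = Y k l) ->
      al *m X *m al^t* = al *m Y *m al^t*.
    move=> XY; apply/matrixP => i j; rewrite !mxE; apply: eq_bigr => l _.
    have -> : (al^t* ) l j = ((al j l)^* )%R by rewrite !mxE.
    case: (boolP (l \in S)) => [lS|/al0 ->]; last by rewrite rmorph0 !mulr0.
    congr (_ * _); rewrite !mxE; apply: eq_bigr => k _.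
    by case: (boolP (k \in S)) => [kS|/al0 ->]; [rewrite XY | rewrite !mul0r].
  rewrite (alM _ M); last by move=> k l kS lS; rewrite mxE kS lS.
  rewrite -Mal; move: hM; rewrite hermsymmxE => /eqP hM.
  by rewrite {1}hM -map_mxM -trmx_mul -Mal -hM.
Qed.

(** A rank at most [n - m] would put [herm (G x + V)] in the image of a chart, hence [V] in the
    image of some [Psi S] with at most [n ^ 2 - m ^ 2 + d.+1] parameters. This is less than [n ^ 2],
    so [lipschitz_avoid] supplies a small [V] outside these images. *)
Theorem perturbation m (G : ('I_d -> R) -> 'M[R]_n) (Lam delta K : R) :
  (m <= n)%N -> (d.+1 < m ^ 2)%N -> 0 <= Lam -> 0 < delta -> 0 <= K ->
  (forall x y (e : R), (forall a, `|x a - y a| <= e) ->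
     forall i j, `|G x i j - G y i j| <= Lam * e) ->
  exists V : 'M[R]_n, (forall i j, `|V i j| <= delta) /\
    forall x c, (forall a, `|x a| <= 1) -> `|c| <= K ->
      (n - m < \rank (herm (G x + V) - (c%:C%C)%:M)%R)%N.
Proof.
move=> mn dm Lam0 d0 K0 GL.
pose B0 : R := \sum_i \sum_j `|G (fun=> 0) i j| + Lam + delta.
have sum_ge : forall i j, `|G (fun=> 0) i j| <= \sum_i \sum_j `|G (fun=> 0) i j|.
  move=> i j; rewrite (bigD1 i) //= (bigD1 j) //= -addrA lerDl.
  by apply: addr_ge0; [|apply: sumr_ge0 => *]; exact: sumr_ge0.
have B0_ge0 : 0 <= B0.
  by rewrite !addr_ge0 ?(ltW d0) //; apply: sumr_ge0 => *; exact: sumr_ge0.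
have GB x (V : 'M[R]_n) i j : (forall a, `|x a| <= 1) -> (forall i j, `|V i j| <= delta) ->
    `|(G x + V) i j| <= B0.
  move=> xB VB; rewrite mxE (le_trans (ler_normD _ _)) // lerD //.
  rewrite -[X in `|X|](subrK (G (fun=> 0) i j)) addrC (le_trans (ler_normD _ _)) //.
  by rewrite lerD // -[X in _ <= X]mulr1 GL // => a; rewrite subr0.
(* [herm] at most doubles the bound [B0] and [K] bounds the eigenvalue; the 1 ensures [1 <= B] for
   [chart_surj], whose parameters are then bounded by [2 * B]. *)
pose B := 1 + 2 * B0 + K.
pose KK := 2 * B.
have KK0 : 0 <= KK by rewrite /KK /B !mulr_ge0 // !addr_ge0 // mulr_ge0.
pose Psi S p (ij : 'I_n * 'I_n) : R :=
  rcoord (chart S p ij.1 ij.2) - G (fun a => p (inr (Some a))) ij.1 ij.2.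
have lipPsi (u : {set 'I_n} * ('I_n * 'I_n)) : lip KK (fun p => Psi u.1 p u.2).
  have [lr li] := lipC_chart u.1 u.2.1 u.2.2 KK0.
  apply: lipD; first exact: lipD.
  apply: lipN; exists Lam; split=> // p p' e _ _ h.
  by apply: GL => a; apply: h.
have [Lf Lf_lip] := choice lipPsi.
pose L : R := \sum_u Lf u.
have L0 : 0 <= L by rewrite sumr_ge0 // => u _; have [] := Lf_lip u.
have Psi_lip (S : {S : {set 'I_n} | (#|S| <= n - m)%N}) p p' (e : R) :
    (forall a, `|p a| <= KK) -> (forall a, `|p' a| <= KK) ->
    (forall a, `|p a - p' a| <= e) ->
    forall b, `|Psi (val S) p b - Psi (val S) p' b| <= L * e.
  move=> pK pK' h b; have [Lf0 Lfl] := Lf_lip (val S, b).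
  have e0 : 0 <= e by apply: le_trans (h (inr None)).
  apply: (le_trans (Lfl p p' e pK pK' h)); rewrite ler_wpM2r //.
  rewrite /L (bigD1 (val S, b)) //= lerDl sumr_ge0 // => u _.
  by have [] := Lf_lip u.
have mn2 : (m ^ 2 <= n ^ 2)%N by rewrite leq_exp2r.
have dim_lt : (n ^ 2 - m ^ 2 + d.+1 < #|{: 'I_n * 'I_n}|)%N.
  by rewrite card_prod !card_ord mulnn; lia.
have supp_le (S : {S : {set 'I_n} | (#|S| <= n - m)%N}) :
    (#|chart_support (val S)| <= n ^ 2 - m ^ 2 + d.+1)%N.
  have /= := valP S; have := card_chart_support (val S).
  move: #|_| #|_| => A B' h1 h2.
  have : (m ^ 2 <= (n - A) ^ 2)%N by rewrite leq_exp2r //; lia.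
  lia.
have [v [vB vP]] := lipschitz_avoid dim_lt supp_le KK0 L0 d0 Psi_lip.
exists (\matrix_(i, j) v (i, j)); split.
  by move=> i j; rewrite mxE; have /andP[v0 v1] := vB (i, j); rewrite ger0_norm.
set V := \matrix_(i, j) v (i, j).
have VB i j : `|V i j| <= delta.
  by rewrite mxE; have /andP[v0 v1] := vB (i, j); rewrite ger0_norm.
move=> x c x1 cK; rewrite ltnNge; apply/negP => rk_le.
have hb := herm_hermsymmx (G x + V).
have bB i j : `|(herm (G x + V) - (c%:C%C)%:M) i j| <= B%:C%C.
  rewrite mxE (le_trans (ler_normD _ _)) //.
  have -> : B%:C%C = (2 * B0)%:C%C + (1 + K)%:C%C :> C.
    by rewrite -rmorphD /=; congr (_%:C%C); rewrite /B; ring.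
  apply: lerD; first by apply: herm_norm => *; exact: GB.
  rewrite !mxE normrN; case: eqP => _; last by rewrite mulr0n normr0 lecR addr_ge0.
  by rewrite mulr1n normc_def /= expr0n addr0 sqrtr_sqr lecR; lra.
have B1 : 1 <= B by rewrite /B; lra.
have KB : K <= 2 * B by rewrite /B; lra.
have [S [p [cardS p0 [pB pc] px bE]]] := chart_surj x hb B1 bB.
have Sle : (#|S| <= n - m)%N by rewrite cardS.
have [|ij] := vP (exist _ S Sle) p _ p0.
  move=> [ij|[a|]]; rewrite ?pB // /KK.
    by have := x1 a; rewrite -px => h; apply: (le_trans h); lra.
  by rewrite pc; exact: le_trans KB.
rewrite /Psi /= px -bE hermK mxE [V _ _]mxE -surjective_pairing addrAC subrr add0r.
by rewrite eqxx.
Qed.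
End Perturbation.

(** * Continuity on the cube *)

Local Open Scope classical_set_scope.
Local Open Scope ring_scope.
Local Open Scope sesquilinear_scope.

Section Continuity.
Variable R : realType.
Local Notation C := (Cplx R).

Lemma continuous_to_mx (T : topologicalType) n (f : T -> 'M[C]_n) :
  (forall x e, 0 < e -> \forall y \near x, forall i j, `|f x i j - f y i j| <= e%:C%C) ->
  continuous f.
Proof.
move=> h x; apply/cvg_ballP => eps eps0.
(* The radius of a ball lives in [C]; being positive, it is real. *)
have [e eE] : exists e, eps = (e%:C%C) by apply/complex_realP/gtr0_real.
have e0 : 0 < e by rewrite -ltcR -eE.
have e20 : 0 < e / 2 by rewrite divr_gt0.
near=> y; split=> // i j; rewrite -ball_normE /=.
apply: (@le_lt_trans _ _ ((e / 2)%:C%C)); last by rewrite eE ltcR; lra.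
by move: i j; near: y; exact: h.
Unshelve. all: by end_near. Qed.

Lemma rcoord_continuous : continuous (@rcoord R : C -> R).
Proof.
move=> z; apply/(@cvgrPdist_lt _ _ _ (nbhs (z : C))) => e e0.
have e40 : 0 < e / 4 by rewrite divr_gt0.
have e4C : 0 < (e / 4)%:C%C :> C by rewrite ltcR.
near=> y.
have /ltW zy : `|z - y| < (e / 4)%:C%C by near: y; exact: (@cvgr_dist_lt _ _ _ _ _ id).
have -> : rcoord z - rcoord y = rcoord (z - y).
  by rewrite /rcoord !raddfB /=; ring.
by apply: (le_lt_trans (rcoord_bound zy)); lra.
Unshelve. all: by end_near. Qed.

Definition clamp (x : R) : R := Num.max 0 (Num.min 1 x).

Lemma clamp_itv x : clamp x \in `[0, 1].
Proof. by rewrite in_itv /= /clamp le_max lexx /= ge_max ler01 /= ge_min lexx. Qed.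

Lemma clamp_id x : x \in `[0, 1] -> clamp x = x.
Proof.
by rewrite in_itv /= => /andP[x0 x1]; rewrite /clamp (min_idPr x1) (max_idPr x0).
Qed.

Lemma clampP x : [\/ clamp x = 0 /\ x <= 0, clamp x = x /\ 0 <= x <= 1
  | clamp x = 1 /\ 1 <= x].
Proof.
rewrite /clamp; have [x1|x1] := leP 1 x; first by constructor 3; rewrite (max_idPr ler01).
have [x0|x0] := leP x 0; first by constructor 1.
by constructor 2; rewrite !ltW.
Qed.

Lemma clamp_lip x y : `|clamp x - clamp y| <= `|x - y|.
Proof.
have := ler_norm (x - y); have := ler_norm (y - x); rewrite -[`|y - x|]normrN opprB => h1 h2.
rewrite ler_norml.
by case: (clampP x) => -[-> ?]; case: (clampP y) => -[-> ?]; apply/andP; split; lra.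
Qed.

Definition cvec r (t : 'rV[R]_r) : 'rV[R]_r := \row_i clamp (t 0 i).

Lemma cvec_cube r (t : 'rV[R]_r) : cube (cvec t).
Proof. by move=> i; rewrite mxE clamp_itv. Qed.

Lemma cvec_id r (t : 'rV[R]_r) : cube t -> cvec t = t.
Proof. by move=> ct; apply/rowP => i; rewrite mxE clamp_id. Qed.

Lemma clamp_continuous : continuous clamp.
Proof.
move=> x; apply/cvgrPdist_lt => e e0; near=> y.
by apply: (le_lt_trans (clamp_lip _ _)); near: y; exact: (@cvgr_dist_lt _ _ _ _ _ id).
Unshelve. all: by end_near. Qed.

Lemma cvec_continuous r : continuous (@cvec r).
Proof.
move=> t; apply/(@cvg_ballP _ _ _ (nbhs t)) => e e0; near=> u; split=> // i j.
rewrite -ball_normE /= !mxE; apply: (le_lt_trans (clamp_lip _ _)).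
have [_ /(_ 0 j)] : ball t e u by near: u; exact: nbhsx_ballx.
by rewrite -ball_normE.
Unshelve. all: by end_near. Qed.

(** Precomposition with the retraction [cvec] onto the cube trades continuity on the cube for
    continuity everywhere. *)
Lemma continuous_comp_cvec r (X : topologicalType) (f : 'rV[R]_r -> X) :
  {within @cube R r, continuous f} -> continuous (fun t => f (cvec t)).
Proof.
move=> /subspace_continuousP cf t U /(cf _ (cvec_cube t)).
move=> /(cvec_continuous (x := t)).
apply: (@filterS _ (nbhs t) _ [set u | cube (cvec u) -> U (f (cvec u))]) => u.
by apply; exact: cvec_cube.
Qed.

Variable r : nat.
Local Notation T := (R * 'rV[R]_r)%type.

Definition coords (q : T) (a : 'I_r.+1) : R :=
  if unlift ord0 a is Some i then q.2 0 i else q.1.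

Definition prism : set T := `[0, 1] `*` @cube R r.

Lemma prism_compact : compact prism.
Proof.
apply: compact_setX; first exact: segment_compact.
exact: (@rV_compact R r (fun=> `[0, 1]%classic) (fun=> @segment_compact R 0 1)).
Qed.

Lemma prism_nonempty : prism !=set0.
Proof.
exists (0, 0); split => /=; first by rewrite in_itv /= lexx ler01.
by move=> i; rewrite mxE in_itv /= lexx ler01.
Qed.

Lemma ball_coords (p q : T) e : 0 < e -> (forall a, `|coords p a - coords q a| < e) ->
  ball p e q.
Proof.
move=> e0 h; split; first by have := h ord0; rewrite /coords unlift_none -ball_normE.
split=> // i j; rewrite -ball_normE /= ord1.
by have := h (lift ord0 j); rewrite /coords liftK.
Qed.

Lemma unif_cont_prism (h : T -> R) delta : continuous h -> 0 < delta ->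
  exists2 eta : R, 0 < eta & forall p q, prism p ->
    (forall a, `|coords p a - coords q a| < eta) -> `|h p - h q| < delta.
Proof.
move=> ch d0.
pose P (eta : R) (p : T) := forall q, ball p eta q -> `|h p - h q| < delta.
have /compact_near_coveringP /(_ R (0^'+) P _) := prism_compact.
case.
  move=> x _; have d20 : 0 < delta / 2 by rewrite divr_gt0.
  have /cvgrPdist_lt/(_ _ d20)/nbhs_ballP[e /= e0 eh] := ch x.
  have e20 : 0 < e / 2 by rewrite divr_gt0.
  (* Half of the radius is spent on the distance from [x] to [p], half on that from [p] to [q]. *)
  exists (ball x (e / 2), [set eta | eta < e / 2]).
    by split; [exact: nbhsx_ballx | exact: nbhs_right_lt].
  move=> [p eta] [/= xp etae] q pq.
  have hxp : `|h x - h p| < delta / 2.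
    by apply: eh; apply: le_ball xp; lra.
  have hxq : `|h x - h q| < delta / 2.
    apply: eh; have := ball_triangle xp pq; apply: le_ball; lra.
  have -> : h p - h q = (h x - h q) - (h x - h p) by ring.
  by apply: (le_lt_trans (ler_normB _ _)); lra.
move=> eta /= eta0 small; exists (eta / 2); first by rewrite divr_gt0.
have e20 : 0 < eta / 2 by rewrite divr_gt0.
move=> p q prismp pq; apply: (small (eta / 2)) => //=.
  by rewrite sub0r normrN ger0_norm ?ltW //; lra.
exact: ball_coords.
Qed.

Lemma bounded_prism (h : T -> R) : continuous h ->
  exists2 B : R, 0 <= B & forall p, prism p -> `|h p| <= B.
Proof.
move=> ch; have ch' : {within prism, continuous (fun p => `|h p|)}.
  apply: continuous_subspaceT => p.
  by apply: continuous_comp; [exact: ch | exact: norm_continuous].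
have [c _ hc] := compact_EVT_max prism_nonempty prism_compact ch'.
by exists `|h c| => // p pp; apply: hc; rewrite inE.
Qed.

(* The approximant is the inf-convolution of [h] with a large multiple of the
   distance. *)
Lemma lipschitz_approx (h : T -> R) delta : continuous h -> 0 < delta ->
  exists (L : R) (g : ('I_r.+1 -> R) -> R),
    [/\ 0 <= L, forall x y (e : R), (forall a, `|x a - y a| <= e) -> `|g x - g y| <= L * e &
        forall q, prism q -> `|g (coords q) - h q| <= delta].
Proof.
move=> ch d0; have [B B0 hB] := bounded_prism ch.
have [eta eta0 hu] := unif_cont_prism ch d0.
(* With this slope a point with some coordinate at least [eta] away pays a penalty of at least
   [2 * B], the largest possible drop of [h]; only points where [h] varies by less than [delta] can
   lower the infimum. *)
pose L0 := 2 * B / eta; have L00 : 0 <= L0 by rewrite divr_ge0 ?mulr_ge0 // ltW.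
pose dist (x y : 'I_r.+1 -> R) := \sum_a `|x a - y a|.
have dist0 x y : 0 <= dist x y by rewrite sumr_ge0.
pose A x := [set h q + L0 * dist x (coords q) | q in prism].
pose g x := inf (A x).
have A0 x : A x !=set0 by apply: image_nonempty; exact: prism_nonempty.
have lbA x : lbound (A x) (- B).
  move=> _ [q pq <-]; have := hB q pq; rewrite ler_norml => /andP[h1 _].
  by apply: (le_trans h1); rewrite lerDl mulr_ge0.
have gle x q : prism q -> g x <= h q + L0 * dist x (coords q).
  by move=> pq; apply: ge_inf; [exists (- B) | exists q].
have distD x y z : dist x z <= dist x y + dist y z.
  rewrite /dist -big_split /=; apply: ler_sum => a _.
  by apply: le_trans (ler_normD _ _); rewrite addrA subrK.
have g_lip x y : g x - g y <= L0 * dist x y.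
  rewrite lerBlDr -lerBlDl; apply: lb_le_inf => // _ [q pq <-].
  rewrite lerBlDl (le_trans (gle x q pq)) //.
  by rewrite addrCA lerD2l -mulrDr ler_wpM2l.
exists (L0 * r.+1%:R), g; split; first by rewrite mulr_ge0.
- move=> x y e xy.
  have le_dist u v : (forall a, `|u a - v a| <= e) -> L0 * dist u v <= L0 * r.+1%:R * e.
    move=> uv; rewrite -mulrA ler_wpM2l // /dist.
    apply: (@le_trans _ _ (\sum_(a < r.+1) e)); first exact: ler_sum.
    by rewrite sumr_const card_ord mulr_natl.
  rewrite ler_norml lerNl opprB; apply/andP; split.
    by apply: (le_trans (g_lip y x)); apply: le_dist => a; rewrite distrC.
  by apply: (le_trans (g_lip x y)); exact: le_dist.
- move=> q pq; have : g (coords q) <= h q.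
    have := gle (coords q) q pq; rewrite /dist big1 ?mulr0 ?addr0 // => a _.
    by rewrite subrr normr0.
  move=> gh; rewrite ler0_norm ?subr_le0 // opprB lerBlDr -lerBlDl.
  apply: lb_le_inf => // _ [p pp <-]; rewrite lerBlDl.
  have [close|far] := pselect (forall a, `|coords q a - coords p a| < eta).
    have := hu q p pq close; rewrite ltr_norml => /andP[_ h2].
    have : 0 <= L0 * dist (coords q) (coords p) by rewrite mulr_ge0.
    by move: h2; set D := L0 * _ => *; lra.
  have [a /negP] : exists a, ~ `|coords q a - coords p a| < eta by apply/existsNP.
  rewrite -leNgt => ea.
  have D2 : 2 * B <= L0 * dist (coords q) (coords p).
    have -> : 2 * B = L0 * eta by rewrite /L0 divfK // gt_eqF.
    rewrite ler_wpM2l // (le_trans ea) // /dist (bigD1 a) //= lerDl.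
    by rewrite sumr_ge0.
  have := hB q pq; have := hB p pp; rewrite !ler_norml => /andP[b1 b2] /andP[b3 b4].
  by move: D2; set D := L0 * _ => *; lra.
Qed.
End Continuity.

(** * The retraction *)

Section Retraction.
Variable R : realType.
Local Notation C := (Cplx R).
Variables (n k l : nat).
Hypotheses (l_gt0 : (0 < l)%N) (le_lk : (l <= k)%N).

Definition unherm (b : 'M[C]_n) : 'M[R]_n := \matrix_(i, j) rcoord (b i j).

(** The two forms differ by a conjugate transpose: one takes columns, [qform] takes rows. *)
Lemma nonneg_definiteE (b : 'M[C]_n) : nonneg_definite b <-> psd b.
Proof.
by split=> -[hb qb]; split=> // v; have := qb (v^t* ); rewrite /qform trmxCK.
Qed.

Lemma psd_rankE (b : 'M[C]_n) : psd_rank R n k l b <-> psd b /\ (l <= \rank b <= k)%N.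
Proof. by rewrite /psd_rank /= nonneg_definiteE. Qed.

Lemma hermB (Y Z : 'M[R]_n) : herm Y - herm Z = herm (Y - Z).
Proof. by apply/eqP; rewrite subr_eq -hermD subrK. Qed.

Lemma real_mulC (c : R) (z : C) :
  c%:C%C * z = ((c * complex.Re z) +i* (c * complex.Im z))%C.
Proof.
case: z => a b; transitivity ((c * a - 0 * b) +i* (c * b + 0 * a))%C; first by [].
by rewrite !mul0r subr0 addr0.
Qed.

Lemma hermZ (c : R) (Y : 'M[R]_n) : herm (c *: Y) = c%:C%C *: herm Y.
Proof.
apply/matrixP => i j; rewrite [RHS]mxE real_mulC !mxE /=.
by congr Complex; field.
Qed.

Lemma topeig_lip j (Y Z : 'M[R]_n) (e : R) : (j < n)%N ->
  (forall i j, `|(Y - Z) i j| <= e) ->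
  `|topeig (herm Y) j - topeig (herm Z) j| <= n%:R * (2 * e).
Proof.
move=> jn le_e; have n0 : (0 < n)%N by apply: leq_ltn_trans jn.
have half (Y' Z' : 'M[R]_n) : (forall i j, `|(Y' - Z') i j| <= e) ->
    topeig (herm Y') j - topeig (herm Z') j <= n%:R * (2 * e).
  move=> h; rewrite lerBlDl.
  have hw : forall i j, `|(herm Y' - herm Z') i j| <= (2 * e)%:C%C.
    by move=> a b; rewrite hermB; exact: herm_norm.
  have hY := herm_hermsymmx Y'; have hZ := herm_hermsymmx Z'.
  have := weyl hY hZ (topeig_is_topeig hY jn) (topeig_is_topeig hZ jn) hw n0.
  by rewrite -(rmorph_nat (@real_complex R)) -rmorphM -rmorphD lecR.
rewrite ler_norml half // andbT lerNl opprB half // => a b.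
by rewrite -opprB mxE normrN.
Qed.

(** As indices start at 0, this is lambda_l - lambda_(k+1). *)
Definition gap (Y : 'M[R]_n) : R := topeig (herm Y) l.-1 - topeig (herm Y) k.

Definition retr (Y : 'M[R]_n) : 'M[C]_n :=
  truncmx (herm Y) (topeig (herm Y) k)%:C%C.

Section SmallK.
Hypothesis lt_kn : (k < n)%N.

Let lt_ln : (l.-1 < n)%N.
Proof. by apply: leq_trans lt_kn; rewrite ltnS (leq_trans _ le_lk) // leq_pred. Qed.

Lemma gap_lip (Y Z : 'M[R]_n) (e : R) : (forall i j, `|(Y - Z) i j| <= e) ->
  `|gap Y - gap Z| <= 4 * n%:R * e.
Proof.
move=> h; have := topeig_lip lt_kn h; have := topeig_lip lt_ln h.
rewrite /gap !ler_norml => /andP[a1 a2] /andP[a3 a4].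
by apply/andP; split; nra.
Qed.

(** The inner summand [n%:R * (2 * e)] accounts for the motion of the subtracted eigenvalue, the
    outer factor for truncation. *)
Lemma retr_lip (Y Z : 'M[R]_n) (e : R) : (forall i j, `|(Y - Z) i j| <= e) ->
  forall i j, `|retr Y i j - retr Z i j| <= (n%:R * (2 * e + n%:R * (2 * e)))%:C%C.
Proof.
move=> h i j; have hY := herm_hermsymmx Y; have hZ := herm_hermsymmx Z.
have real_top X : ((topeig (herm X) k)%:C%C : C) \is Num.real by apply/complex_realP; eexists.
have -> : (n%:R * (2 * e + n%:R * (2 * e)))%:C%C =
    n%:R * (2 * e + n%:R * (2 * e))%:C%C :> C by rewrite rmorphM rmorph_nat.
have -> : retr Y i j - retr Z i j = (retr Y - retr Z) i j by rewrite !mxE.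
apply: truncmx_lipschitz => // a b.
have -> : herm Y - (topeig (herm Y) k)%:C%C%:M - (herm Z - (topeig (herm Z) k)%:C%C%:M) =
   herm (Y - Z) - ((topeig (herm Y) k - topeig (herm Z) k)%:C%C)%:M.
  have scalB (x y : R) : ((x - y)%:C%C)%:M = (x%:C%C)%:M - (y%:C%C)%:M :> 'M[C]_n.
    by rewrite -raddfB /= -rmorphB.
  by rewrite -hermB scalB !opprD !opprK addrACA.
have -> : (2 * e + n%:R * (2 * e))%:C%C = (2 * e)%:C%C + (n%:R * (2 * e))%:C%C :> C.
  by rewrite -rmorphD.
rewrite mxE (le_trans (ler_normD _ _)) // lerD //; first exact: herm_norm.
have e0 : 0 <= e by apply: le_trans (h i j).
rewrite !mxE normrN; case: eqP => _; last by rewrite mulr0n normr0 lecR !mulr_ge0.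
by rewrite mulr1n normc_def /= expr0n addr0 sqrtr_sqr lecR topeig_lip.
Qed.

(** The rank counts the eigenvalues above lambda_(k+1): there are at most [k], and a positive gap
    puts the first [l] among them. *)
Lemma retr_psd_rank Y : 0 < gap Y -> psd_rank R n k l (retr Y).
Proof.
move=> gY; apply/psd_rankE; split; first exact: psd_truncmx.
have hY := herm_hermsymmx Y.
have [cr kP _] := topeig_is_topeig hY lt_kn; have [_ lP _] := topeig_is_topeig hY lt_ln.
rewrite /retr rank_truncmx // -kP // lexx andbT.
have := lP _ cr; rewrite lecR.
have -> : topeig (herm Y) l.-1 <= topeig (herm Y) k = false.
  by apply/negbTE; rewrite -ltNge; move: gY; rewrite /gap subr_gt0.
by move=> /esym/negbT; rewrite -ltnNge prednK.
Qed.

(** Rank at most [k] and nonnegativity force lambda_(k+1) = 0, so nothing is truncated; rank at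
    least [l] makes lambda_l positive. *)
Lemma psd_rank_retr b : psd_rank R n k l b ->
  0 < gap (unherm b) /\ retr (unherm b) = b.
Proof.
move=> /psd_rankE[pb /andP[lb bk]]; have [hb _] := pb.
have hE : herm (unherm b) = b := rcoordK hb.
have [cr kP _] := topeig_is_topeig hb lt_kn; have [cr' lP _] := topeig_is_topeig hb lt_ln.
have r0 : (0 : C) \is Num.real by exact: real0.
have top0 : topeig b k = 0.
  apply/le_anti/andP; split.
    by rewrite -lecR kP // -rank_psd.
  rewrite leNgt; apply/negP => neg.
  have := lexx (topeig b k)%:C%C; rewrite {1}kP // leqNgt => /negP; apply.
  have -> : [set i | (((topeig b k)%:C)%C < spectral_diag b 0 i)%R]%SET = finset.setTfor _.
    apply/setP => i; rewrite !inE; apply: (@lt_le_trans _ _ 0); first by rewrite ltcR.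
    exact: psd_spectral_diag.
  by rewrite cardsT card_ord.
rewrite /gap /retr hE top0 subr0; split; last exact: truncmx0.
rewrite ltNge; apply/negP => le0; have := lP 0 r0; rewrite -rank_psd //.
by rewrite lecR le0 => /esym; rewrite leqNgt prednK // lb.
Qed.

Lemma gap_le0 Y : gap Y <= 0 ->
  (\rank (herm Y - ((topeig (herm Y) k)%:C%C)%:M)%R <= n - (k - l + 2))%N.
Proof.
move=> g0; have hY := herm_hermsymmx Y.
have := rank_is_topeig hY (topeig_is_topeig hY lt_ln) (topeig_is_topeig hY lt_kn).
rewrite lecR -subr_le0 => /(_ g0); move: lt_kn l_gt0 le_lk.
move: (\rank _) => rk *; lia.
Qed.

End SmallK.
End Retraction.

(** * Homotopies relative to the boundary *)

Section Homotopy.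
Variable R : realType.
Local Notation C := (Cplx R).
Variables (n k l r : nat).
Local Notation S := (psd_rank_space R n k l).
Local Notation T := (R * 'rV[R]_r)%type.

Lemma entries_near (X : topologicalType) (F : X -> 'M[R]_n) :
  (forall i j, continuous (fun x => F x i j)) ->
  forall (x : X) (e : R), 0 < e -> \forall y \near x, forall i j, `|(F x - F y) i j| <= e.
Proof.
move=> cF x e e0; apply: filter_forall => i; apply: filter_forall => j.
have /cvgrPdist_le/(_ _ e0) := cF i j x.
by apply: filterS => y; rewrite !mxE.
Qed.

Lemma continuous_lip_comp (X : topologicalType) (F : X -> 'M[R]_n)
    (phi : 'M[R]_n -> R) (L : R) : 0 <= L ->
  (forall i j, continuous (fun x => F x i j)) ->
  (forall (Y Z : 'M[R]_n) (e : R), (forall i j, `|(Y - Z) i j| <= e) ->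
     `|phi Y - phi Z| <= L * e) ->
  continuous (fun x => phi (F x)).
Proof.
move=> L0 cF hphi x; apply/cvgrPdist_le => e e0.
have L1 : 0 < L + 1 by lra.
have e1 : 0 < e / (L + 1) by rewrite divr_gt0.
have := entries_near cF x e1; apply: filterS => y h.
apply: (le_trans (hphi _ _ _ h)).
by rewrite mulrCA ler_piMr ?(ltW e0) // ler_pdivrMr // mul1r; lra.
Qed.

Definition space_coord (f : 'rV[R]_r -> S) (t : 'rV[R]_r) : 'M[R]_n :=
  unherm (\val (f (cvec t))).

Lemma space_coord_continuous (f : 'rV[R]_r -> S) i j :
  {within @cube R r, continuous f} -> continuous (fun t => space_coord f t i j).
Proof.
move=> /continuous_comp_cvec cf t.
have -> : (fun t => space_coord f t i j) =
    (@rcoord R \o (fun M : 'M[C]_n => M i j)) \o (set_val \o (fun t => f (cvec t))).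
  by apply: funext => u; rewrite /space_coord /unherm mxE.
apply: continuous_comp.
  by apply: continuous_comp; [exact: cf | exact: initial_continuous].
by apply: continuous_comp; [exact: coord_continuous | exact: rcoord_continuous].
Qed.

Lemma set_val_psd_rank (x : S) : psd_rank R n k l (\val x).
Proof. exact: set_valP. Qed.

Lemma lift_homotopy (H : T -> 'M[C]_n) (HS : forall q, psd_rank R n k l (H q)) :
  continuous H ->
  continuous (fun q => SigSub (mem_set (HS q)) : S).
Proof.
move=> cH; apply: (@continuous_comp_initial _ _ _ set_val).
by rewrite (_ : _ \o _ = H).
Qed.

Lemma comp_fst_continuous (X : topologicalType) (h : R -> X) :
  continuous h -> continuous (fun q : T => h q.1).
Proof.
by move=> ch q; apply: continuous_comp; [exact: cvg_fst | exact: ch].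
Qed.

Lemma comp_snd_continuous (X : topologicalType) (h : 'rV[R]_r -> X) :
  continuous h -> continuous (fun q : T => h q.2).
Proof.
by move=> ch q; apply: continuous_comp; [exact: cvg_snd | exact: ch].
Qed.

Definition straight (f g : 'rV[R]_r -> S) (q : T) : 'M[R]_n :=
  space_coord f q.2 + clamp q.1 *: (space_coord g q.2 - space_coord f q.2).

Lemma straight_continuous (f g : 'rV[R]_r -> S) i j :
  {within @cube R r, continuous f} -> {within @cube R r, continuous g} ->
  continuous (fun q => straight f g q i j).
Proof.
move=> cf' cg' q.
have cf := comp_snd_continuous (@space_coord_continuous f i j cf').
have cg := comp_snd_continuous (@space_coord_continuous g i j cg').
have -> : (fun q => straight f g q i j) = (fun q : T => space_coord f q.2 i j +
   clamp q.1 * (space_coord g q.2 i j - space_coord f q.2 i j)).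
  by apply: funext => p; rewrite /straight !mxE.
have cc := comp_fst_continuous (@clamp_continuous R).
rewrite /continuous_at; apply: cvgD; first exact: cf.
by apply: cvgM; [exact: cc | apply: cvgB; [exact: cg | exact: cf]].
Qed.

Lemma straight0 f g t : straight f g (0, t) = space_coord f t.
Proof. by rewrite /straight /= clamp_id ?scale0r ?addr0 // in_itv /= lexx ler01. Qed.

Lemma straight1 f g t : straight f g (1, t) = space_coord g t.
Proof.
rewrite /straight /= clamp_id ?in_itv /= ?lexx ?ler01 //.
by rewrite scale1r addrC subrK.
Qed.

Lemma straight_eq f g s t : cube t -> f t = g t ->
  straight f g (s, t) = space_coord f t.
Proof.
by move=> ct fg; rewrite /straight /space_coord /= cvec_id // fg subrr scaler0 addr0.
Qed.

Lemma herm_space_coord f t : herm (space_coord f t) = \val (f (cvec t)).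
Proof.
have /psd_rankE[[hb _] _] := set_val_psd_rank (f (cvec t)).
exact: rcoordK.
Qed.

Lemma psd_rank_convex (a b : 'M[C]_n) (c : C) : k = n -> 0 <= c <= 1 ->
  psd_rank R n k l a -> psd_rank R n k l b ->
  psd_rank R n k l (a + c *: (b - a)).
Proof.
move=> kn c01 /psd_rankE[pa /andP[la _]] /psd_rankE[pb /andP[lb _]].
have [pc lc] := psd_convex pa pb c01 la lb.
by apply/psd_rankE; split=> //; rewrite lc kn rank_leq_row.
Qed.

(** The boundary values are those of [f] instead of a base point, so the notion serves both paths
    and spheroids. *)
Definition rel_homotopy (f g : 'rV[R]_r -> S) := exists H : T -> S,
  [/\ continuous H, forall t, cube t -> H (0, t) = f t,
      forall t, cube t -> H (1, t) = g t &
      forall s t, s \in `[0, 1] -> cube_boundary t -> H (s, t) = f t].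

Lemma rel_homotopy_mx (f g : 'rV[R]_r -> S) (H : T -> 'M[C]_n) :
  (forall q, psd_rank R n k l (H q)) -> continuous H ->
  (forall t, cube t -> H (0, t) = \val (f t)) ->
  (forall t, cube t -> H (1, t) = \val (g t)) ->
  (forall s t, s \in `[0, 1] -> cube_boundary t -> H (s, t) = \val (f t)) ->
  rel_homotopy f g.
Proof.
move=> HS cH H0 H1 Hb; exists (fun q => SigSub (mem_set (HS q)) : S); split.
- exact: lift_homotopy.
- by move=> t ct; apply: val_inj => /=; exact: H0.
- by move=> t ct; apply: val_inj => /=; exact: H1.
- by move=> s t s01 bt; apply: val_inj => /=; exact: Hb.
Qed.

Lemma herm_lip (Y Z : 'M[R]_n) (e : R) : (forall i j, `|(Y - Z) i j| <= e) ->
  forall i j, `|herm Y i j - herm Z i j| <= (2 * e)%:C%C.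
Proof.
move=> h i j; have -> : herm Y i j - herm Z i j = herm (Y - Z) i j.
  by rewrite -hermB [RHS]mxE; congr (_ + _); rewrite [RHS]mxE.
exact: herm_norm.
Qed.

Lemma rel_homotopy_full f g : k = n ->
  {within @cube R r, continuous f} -> {within @cube R r, continuous g} ->
  (forall t, cube_boundary t -> f t = g t) -> rel_homotopy f g.
Proof.
move=> kn cf cg fg; apply: (@rel_homotopy_mx _ _ (fun q => herm (straight f g q))).
- move=> q; rewrite /straight hermD hermZ -hermB !herm_space_coord.
  apply: psd_rank_convex => //; try exact: set_val_psd_rank.
  by have := clamp_itv q.1; rewrite in_itv !lecR.
- apply: continuous_to_mx => x e e0.
  have e20 : 0 < e / 2 by rewrite divr_gt0.
  have := entries_near (fun i j => @straight_continuous f g i j cf cg) x e20.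
  apply: filterS => y h i j; apply: (le_trans (herm_lip h i j)).
  by rewrite lecR; lra.
- by move=> t ct; rewrite straight0 herm_space_coord cvec_id.
- by move=> t ct; rewrite straight1 herm_space_coord cvec_id.
- move=> s t _ bt; have [ct _] := bt.
  by rewrite (straight_eq s ct (fg t bt)) herm_space_coord cvec_id.
Qed.

End Homotopy.

(** * Homotopies in the case k < n *)

Section SmallRank.
Variable R : realType.
Local Notation C := (Cplx R).
Variables (n k l r : nat).
Hypotheses (l_gt0 : (0 < l)%N) (le_lk : (l <= k)%N) (lt_kn : (k < n)%N).
Local Notation S := (psd_rank_space R n k l).
Local Notation T := (R * 'rV[R]_r)%type.

Lemma cube_compact : compact (@cube R r).
Proof. exact: (@rV_compact R r (fun=> `[0, 1]%classic) (fun=> @segment_compact R 0 1)). Qed.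

(** The gap is continuous and positive at points of the space, and the cube is compact. *)
Lemma gap_bounded_below (f : 'rV[R]_r -> S) : {within @cube R r, continuous f} ->
  exists2 gamma : R, 0 < gamma & forall t, gamma <= gap k l (space_coord f t).
Proof.
move=> cf; pose h t := gap k l (space_coord f t).
have ch : continuous h.
  apply: (@continuous_lip_comp _ _ _ (space_coord f) (gap k l) (4 * n%:R)) => //.
  - by rewrite mulr_ge0.
  - by move=> i j; exact: space_coord_continuous.
  - by move=> Y Z e; exact: gap_lip.
have cube0 : @cube R r !=set0.
  by exists 0 => i; rewrite mxE in_itv /= lexx ler01.
have [c _ hc] := compact_EVT_min cube0 cube_compact (continuous_subspaceT ch).
exists (h c).
  by have [] := psd_rank_retr l_gt0 le_lk lt_kn (set_val_psd_rank (f (cvec c))).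
move=> t; have := hc (cvec t); rewrite inE => /(_ (cvec_cube t)).
by rewrite /h /space_coord (cvec_id (cvec_cube t)).
Qed.

Definition clamp_prism (q : T) : T := (clamp q.1, cvec q.2).

Lemma clamp_prism_prism q : prism (clamp_prism q).
Proof. by split; [exact: clamp_itv | exact: cvec_cube]. Qed.

Lemma coords_clamp_prism (q p : T) a :
  `|coords (clamp_prism q) a - coords (clamp_prism p) a| <= `|coords q a - coords p a|.
Proof.
rewrite /coords; case: unliftP => [j _|_] /=; last exact: clamp_lip.
by rewrite !mxE clamp_lip.
Qed.

Lemma coords_prism (q : T) a : prism q -> `|coords q a| <= 1.
Proof.
move=> [q1 q2]; rewrite /coords; case: unliftP => [j _|_].
  by have := q2 j; rewrite in_itv /= => /andP[h1 h2]; rewrite ger0_norm.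
by move: q1 => /=; rewrite in_itv /= => /andP[h1 h2]; rewrite ger0_norm.
Qed.

Lemma coords_ball (q p : T) e a : ball q e p -> `|coords q a - coords p a| <= e.
Proof.
move=> [b1 [_ b2]]; rewrite /coords; case: unliftP => [j _|_].
  by have := b2 0 j; rewrite -ball_normE /= => /ltW.
by move: b1; rewrite -ball_normE /= => /ltW.
Qed.

Lemma lipschitz_coords_continuous (g : ('I_r.+1 -> R) -> R) (L : R) : 0 <= L ->
  (forall x y (e : R), (forall a, `|x a - y a| <= e) -> `|g x - g y| <= L * e) ->
  continuous (fun q : T => g (coords (clamp_prism q))).
Proof.
move=> L0 hg q; apply/(@cvgrPdist_le _ _ _ (nbhs (q : T))) => e e0.
have L1 : 0 < L + 1 by lra.
have e1 : 0 < e / (L + 1) by rewrite divr_gt0.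
near=> p.
have qp : ball q (e / (L + 1)) p by near: p; exact: nbhsx_ballx.
have h a : `|coords (clamp_prism q) a - coords (clamp_prism p) a| <= e / (L + 1).
  by apply: (le_trans (coords_clamp_prism _ _ _)); exact: coords_ball.
apply: (le_trans (hg _ _ _ h)).
by rewrite mulrCA ler_piMr ?(ltW e0) // ler_pdivrMr // mul1r; lra.
Unshelve. all: by end_near. Qed.

Lemma straight_clamp_prism (f g : 'rV[R]_r -> S) q :
  straight f g (clamp_prism q) = straight f g q.
Proof.
rewrite /straight /space_coord /= (cvec_id (cvec_cube _)) clamp_id //.
exact: clamp_itv.
Qed.

(** Half of [delta] goes to the Lipschitz approximation and half to the translation [V]. By
    [gap_le0] a nonpositive gap would give an eigenvalue of multiplicity at least [k - l + 2], which
    [V] was chosen to avoid. *)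
Lemma avoid_gap (F : T -> 'M[R]_n) (delta : R) :
  (r <= 2 * (k - l) + 1)%N -> 0 < delta ->
  (forall i j, continuous (fun q => F q i j)) ->
  exists F' : T -> 'M[R]_n, [/\ forall i j, continuous (fun q => F' q i j),
    forall q i j, `|(F' q - F (clamp_prism q)) i j| <= delta &
    forall q, 0 < gap k l (F' q)].
Proof.
move=> le_r d0 cF; have d20 : 0 < delta / 2 by rewrite divr_gt0.
have approx (u : 'I_n * 'I_n) : exists p : R * (('I_r.+1 -> R) -> R),
    [/\ 0 <= p.1, forall x y (e : R), (forall a, `|x a - y a| <= e) ->
        `|p.2 x - p.2 y| <= p.1 * e &
        forall q, prism q -> `|p.2 (coords q) - F q u.1 u.2| <= delta / 2].
  by have [L [g [h1 h2 h3]]] := lipschitz_approx (cF u.1 u.2) d20; exists (L, g).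
have [p pP] := choice approx.
have bdd (u : 'I_n * 'I_n) : exists B : R, 0 <= B /\
    forall q, prism q -> `|F q u.1 u.2| <= B.
  by have [B B0 hB] := bounded_prism (cF u.1 u.2); exists B.
have [b bP] := choice bdd.
have le_sum (h : 'I_n * 'I_n -> R) u : (forall v, 0 <= h v) -> h u <= \sum_v h v.
  by move=> h0; rewrite (bigD1 u) //= lerDl sumr_ge0.
have p0 u : 0 <= (p u).1 by case: (pP u).
have b0 u : 0 <= b u by case: (bP u).
pose Lam : R := \sum_u (p u).1; pose B : R := \sum_u b u.
have Lam0 : 0 <= Lam by rewrite sumr_ge0.
have B0 : 0 <= B by rewrite sumr_ge0.
pose GG (x : 'I_r.+1 -> R) : 'M[R]_n := \matrix_(i, j) (p (i, j)).2 x.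
have GG_lip x y (e : R) : (forall a, `|x a - y a| <= e) ->
    forall i j, `|GG x i j - GG y i j| <= Lam * e.
  move=> xy i j; have [_ h _] := pP (i, j); rewrite !mxE.
  have e0 : 0 <= e by apply: le_trans (xy ord0).
  by apply: (le_trans (h _ _ _ xy)); rewrite ler_wpM2r // (le_sum (fun u => (p u).1)).
(* This bounds the eigenvalue of index [k] along [F'], by comparison with the zero matrix through
   [topeig_lip]. *)
pose K : R := `|topeig (herm (0 : 'M[R]_n)) k| + n%:R * (2 * (B + delta)).
have K0 : 0 <= K by rewrite addr_ge0 // !mulr_ge0 // addr_ge0 // ltW.
pose m := (k - l + 2)%N.
have mn : (m <= n)%N by rewrite /m; move: l_gt0 le_lk lt_kn; lia.
(* The prism has dimension [r.+1] and the eigenvalue adds one parameter; with [c = k - l],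
   [r.+2 <= 2 * c + 3 < (c + 2) ^ 2]. *)
have dm : (r.+2 < m ^ 2)%N by rewrite /m -mulnn; move: le_r; move: (k - l)%N => c; nia.
have [V [VB VP]] := perturbation mn dm Lam0 d20 K0 GG_lip.
pose F' q := GG (coords (clamp_prism q)) + V.
have F'F q i j : `|(F' q - F (clamp_prism q)) i j| <= delta.
  have [_ _ h] := pP (i, j); have h' := h _ (clamp_prism_prism q).
  have -> : (F' q - F (clamp_prism q)) i j =
    ((p (i, j)).2 (coords (clamp_prism q)) - F (clamp_prism q) i j) + V i j.
    by rewrite !mxE; ring.
  rewrite (le_trans (ler_normD _ _)) // [leRHS](_ : _ = delta / 2 + delta / 2); last by field.
  exact: lerD.
exists F'; split=> //.
- move=> i j; have [L0 hL _] := pP (i, j) => q.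
  have -> : (fun q => F' q i j) = (fun q => (p (i, j)).2 (coords (clamp_prism q)) + V i j).
    by apply: funext => x; rewrite !mxE.
  rewrite /continuous_at; apply: cvgD; last exact: cvg_cst.
  exact: lipschitz_coords_continuous hL q.
- move=> q; rewrite ltNge; apply/negP => /(gap_le0 l_gt0 le_lk lt_kn).
  rewrite leqNgt => /negP; apply; apply: VP.
    by move=> a; apply: coords_prism; exact: clamp_prism_prism.
  have F'B i j : `|(F' q - 0) i j| <= B + delta.
    have [_ h] := bP (i, j); have h' := h _ (clamp_prism_prism q).
    have -> : (F' q - 0) i j = (F' q - F (clamp_prism q)) i j + F (clamp_prism q) i j.
      by rewrite subr0 [X in _ = X + _]mxE [X in _ = _ + X + _]mxE subrK.
    rewrite addrC (le_trans (ler_normD _ _)) // lerD // (le_trans h') //.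
    exact: (le_sum b).
  have := topeig_lip lt_kn F'B.
  set x := topeig _ k; set y := topeig _ k => h.
  rewrite -[x](subrK y) (le_trans (ler_normD _ _)) // addrC /K lerD //.
Qed.

Lemma rel_homotopy_small (f g : 'rV[R]_r -> S) : (r <= 2 * (k - l) + 1)%N ->
  {within @cube R r, continuous f} -> {within @cube R r, continuous g} ->
  (forall t, cube_boundary t -> f t = g t) -> rel_homotopy f g.
Proof.
move=> le_r cf cg fg; pose F := straight f g.
have cF i j : continuous (fun q => F q i j) by exact: straight_continuous.
have [gf gf0 hgf] := gap_bounded_below cf; have [gg gg0 hgg] := gap_bounded_below cg.
pose gamma := Num.min gf gg.
have gamma0 : 0 < gamma by rewrite /gamma lt_min gf0.
have n1 : 0 < n%:R + 1 :> R by rewrite ltr_wpDl.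
(* By [gap_lip], a move of size [delta] changes the gap by at most [gamma / 4]. *)
pose delta := gamma / (16 * (n%:R + 1)).
have d0 : 0 < delta by rewrite divr_gt0 // mulr_gt0.
have [F' [cF' F'F gapF']] := avoid_gap le_r d0 cF.
have {}F'F q i j : `|(F' q - F q) i j| <= delta.
  by have := F'F q i j; rewrite /F straight_clamp_prism.
(* This cutoff is 1 where the gap is at most [gamma / 2] and 0 where it is at least [gamma]. *)
pose phi q := clamp (2 - 2 / gamma * gap k l (F q)).
have gapc : continuous (fun q => gap k l (F q)).
  apply: (@continuous_lip_comp _ _ _ F (gap k l) (4 * n%:R)) => //.
  - by rewrite mulr_ge0.
  - by move=> Y Z e; exact: gap_lip.
have cphi : continuous phi.
  pose psi q := 2 - 2 / gamma * gap k l (F q).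
  have cpsi : continuous psi.
    move=> q; rewrite /continuous_at /psi; apply: cvgB; first exact: cvg_cst.
    by apply: cvgM; [exact: cvg_cst | exact: gapc].
  rewrite (_ : phi = @clamp R \o psi) // => q.
  exact: continuous_comp (cpsi q) (@clamp_continuous R _).
pose G q := F q + phi q *: (F' q - F q).
have cG i j : continuous (fun q => G q i j).
  move=> q; have -> : (fun q => G q i j) = (fun q => F q i j + phi q * (F' q i j - F q i j)).
    by apply: funext => p; rewrite /G !mxE.
  rewrite /continuous_at; apply: cvgD; first exact: cF.
  by apply: cvgM; [exact: cphi | apply: cvgB; [exact: cF' | exact: cF]].
have arg_eq q : gamma * (2 - 2 / gamma * gap k l (F q)) = 2 * gamma - 2 * gap k l (F q).
  by field; rewrite gt_eqF.
have gapG q : 0 < gap k l (G q).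
  have phi_itv : 0 <= phi q <= 1.
    by have := clamp_itv (2 - 2 / gamma * gap k l (F q)); rewrite in_itv.
  (* Where the gap of [F] exceeds [gamma / 2], a partial move towards [F'] keeps it positive;
     elsewhere [G] is [F']. *)
  have near_F : 0 < gap k l (F q) - gamma / 2 -> 0 < gap k l (G q).
    move=> h; have GF i j : `|(G q - F q) i j| <= delta.
      have -> : (G q - F q) i j = phi q * (F' q - F q) i j by rewrite /G addrC addKr mxE.
      have /andP[h0 h1] := phi_itv.
      rewrite normrM (ger0_norm h0) (le_trans _ (F'F q i j)) // ler_piMl //.
    have := gap_lip le_lk lt_kn GF; rewrite ler_norml => /andP[h1 _].
    have : 4 * n%:R * delta <= gamma / 4.
      have -> : gamma / 4 = 4 * (n%:R + 1) * delta.
        by rewrite /delta; field; rewrite gt_eqF.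
      by rewrite ler_pM2r // ler_pM2l // lerDl.
    by move: h h1; lra.
  move: near_F; rewrite /G /phi; have := arg_eq q; set z := 2 - _ => zE.
  case: (clampP z) => -[-> h].
  - by move=> near_F; apply: near_F; nra.
  - have [->|ne1] := eqVneq z 1; first by move=> _; rewrite scale1r addrC subrK.
    move=> near_F; apply: near_F.
    have z1 : z < 1 by rewrite lt_neqAle ne1; case/andP: h.
    nra.
  - by move=> _; rewrite scale1r addrC subrK.
(* This applies at both ends of the prism and over the boundary of the cube, where [F] takes values
   of [f] or [g]. *)
have FE q : gamma <= gap k l (F q) -> G q = F q.
  move=> h; rewrite /G /phi; have := arg_eq q; set z := 2 - _ => zE.
  have z0 : z <= 0 by nra.
  case: (clampP z) => -[-> h1]; rewrite ?scale0r ?addr0 //; last by exfalso; lra.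
  by have -> : z = 0 by [case/andP: h1 => h1 _; lra]; rewrite scale0r addr0.
have retrE (h : 'rV[R]_r -> S) t : cube t -> retr k (space_coord h t) = \val (h t).
  move=> ct; rewrite /space_coord cvec_id //.
  by have [_ ->] := psd_rank_retr l_gt0 le_lk lt_kn (set_val_psd_rank (h t)).
apply: (@rel_homotopy_mx _ _ _ _ _ _ _ (fun q => retr k (G q))).
- by move=> q; exact: retr_psd_rank.
- apply: continuous_to_mx => q e e0.
  pose L : R := n%:R * (2 + n%:R * 2) + 1.
  have L0 : 0 < L by rewrite ltr_wpDl // !mulr_ge0 // addr_ge0 // mulr_ge0.
  have e1 : 0 < e / L by rewrite divr_gt0.
  have := entries_near cG q e1; apply: filterS => p h i j.
  apply: (le_trans (retr_lip lt_kn h i j)); rewrite lecR.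
  have -> : n%:R * (2 * (e / L) + n%:R * (2 * (e / L))) = (L - 1) * (e / L).
    by rewrite /L; ring.
  by rewrite mulrBl mul1r mulrC divfK ?gt_eqF // gerBl ltW.
- move=> t ct; rewrite FE /F straight0 ?retrE //.
  by apply: (le_trans _ (hgf t)); rewrite ge_min lexx.
- move=> t ct; rewrite FE /F straight1 ?retrE //.
  by apply: (le_trans _ (hgg t)); rewrite ge_min lexx orbT.
- move=> s t _ bt; have [ct _] := bt.
  rewrite FE /F (straight_eq s ct (fg t bt)) ?retrE //.
  by apply: (le_trans _ (hgf t)); rewrite ge_min lexx.
Qed.

End SmallRank.

(** * Vanishing of the homotopy groups *)

Lemma psd_rank_nonempty (R : realType) (n k l : nat) :
  (l <= k)%N -> (k <= n)%N -> psd_rank R n k l (pid_mx l).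
Proof.
move=> lk kn; apply/psd_rankE; split; last first.
  by have ln := leq_trans lk kn; rewrite rank_pid_mx // leqnn.
have -> : pid_mx l = specmx 1%:M (\row_i ((i < l)%N)%:R) :> 'M[Cplx R]_n.
  rewrite /specmx trmx1 map_mx1 mul1mx mulmx1; apply/matrixP => i j; rewrite !mxE.
  by rewrite -[RHS]mulr_natr -natrM -val_eqE mulnb andbC.
by apply: psd_specmx => i; rewrite mxE ler0n.
Qed.

Theorem corollary3p6 (R : realType) (n k l r : nat)
  (l_gt0 : (0 < l)%N) (le_lk : (l <= k)%N) (le_kn : (k <= n)%N)
  (le_r : (r <= 2 * (k - l) + 1)%N) :
  homotopy_group_vanishes R r (psd_rank_space R n k l).
Proof.
pose S := psd_rank_space R n k l.
have rel (f g : 'rV[R]_r -> S) : {within @cube R r, continuous f} ->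
    {within @cube R r, continuous g} ->
    (forall t, cube_boundary t -> f t = g t) -> rel_homotopy f g.
  have [lt_kn|ge_kn] := ltnP k n; first exact: rel_homotopy_small.
  by apply: rel_homotopy_full; apply/eqP; rewrite eqn_leq le_kn.
(* The 0-cube is a point with empty boundary, so the constant maps at [x] and [y] are homotopic, and
   following that point gives a path. *)
case: r le_r rel => [|r] le_r rel.
  split; first by constructor; exact: (SigSub (mem_set (psd_rank_nonempty R le_lk le_kn))).
  move=> x y; have [||t [_ [[]]]//|H [cH H0 H1 _]] := rel (cst x) (cst y).
  - by apply: continuous_subspaceT; exact: cst_continuous.
  - by apply: continuous_subspaceT; exact: cst_continuous.
  - exists (fun s => H (s, 0)); split.
    + apply: continuous_subspaceT => s.
      apply: (@continuous_comp R (R * 'rV[R]_0)%type S (fun s => (s, 0)) H);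
        last exact: cH.
      exact: (@cvg_pair _ _ _ (nbhs s) (nbhs s) (nbhs (0 : 'rV[R]_0)) _ _ _
        id (cst 0) cvg_id (cvg_cst _)).
    + by rewrite H0 // => -[].
    + by rewrite H1 // => -[].
move=> x0 /=.
(* Any two spheroids agree on the boundary, so [rel] makes them homotopic and there is a single
   class. *)
have classE (f : 'rV[R]_r.+1 -> S) : spheroid x0 f -> homotopy_class x0 f = spheroid x0.
  move=> [cf fb]; apply/seteqP; split=> [g [] //|g [cg gb]]; split=> //.
  have [|H [cH H0 H1 Hb]] := rel f g cf cg; first by move=> t bt; rewrite fb // gb.
  exists H; split=> //; first exact: continuous_subspaceT.
  by move=> s t s01 bt; rewrite Hb // fb.
have sph_cst : spheroid x0 (cst x0 : 'rV[R]_r.+1 -> S).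
  by split=> //; apply: continuous_subspaceT; exact: cst_continuous.
apply/seteqP; split=> [_ [f sf <-]|_ ->] /=; first by rewrite !classE.
by exists (cst x0).
Qed.
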